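(* Let $d\ge3$, let $U=[-\frac12,\frac12]^d$, and for $N\in\mathbb N$ let $\Lambda_N=L_NU$ be the centred box with volume $L_N^d=N/\rho$. Fix $\beta,\rho\in(0,\infty)$. Let $\gamma_N^{(\Lambda_N,\mathrm{free})}$ be the kernel of the free Bose gas with free boundary condition. Then the following hold. (i) (Supercritical regime: $\rho>\rho_{\mathrm c}$.) If $\rho>\rho_{\mathrm c}$, then, uniformly in $x,y\in\Lambda_N$, as $N\to\infty$, $$\gamma_N^{(\Lambda_N,\mathrm{free})}(x,y)=\rho-\rho_{\mathrm c}+\psi(|x-y|)+o(1),$$ for some function $\psi\colon(0,\infty)\to(0,\infty)$ that satisfies $\psi(r)\le O(r^{2-d})$ as $r\to\infty$. (ii) (Subcritical regime: $\rho\le\rho_{\mathrm c}$.) If $\rho\le\rho_{\mathrm c}$, then for some $c>0$ and all $x,y\in\Lambda_N$, as $N\to\infty$, $$\gamma_N^{(\Lambda_N,\mathrm{free})}(x,y)=O\big(e^{-c|x-y|}\big).$$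
   Context: $\rho_{\mathrm c}=\sum_{k\in\mathbb N}(2\pi\beta k)^{-d/2}<\infty$ for $d\ge3$. **Free boundary condition.** Put $g^{(\mathrm{free})}_{t}(x,y)=(2\pi t)^{-d/2}e^{-|x-y|^2/(2t)}$ for $x,y\in\mathbb R^d$, $t>0$. For a centred box $\Lambda$, let $(X_k)_{k\in\mathbb N}$ be independent under the probability measure $\mathtt P^{(\mathrm{free})}_\Lambda$, where $X_k$ is Poisson distributed with parameter $\frac1k\int_\Lambda g^{(\mathrm{free})}_{k\beta}(x,x)\,dx=\frac1k|\Lambda|(2\pi\beta k)^{-d/2}$, and let $\mathrm N_\Lambda=\sum_{k\in\mathbb N}kX_k$. The kernel is defined by $$\gamma_N^{(\Lambda,\mathrm{free})}(x,y)=\sum_{r=1}^Ng^{(\mathrm{free})}_{r\beta}(x,y)\,\frac{\mathtt P^{(\mathrm{free})}_\Lambda(\mathrm N_\Lambda=N-r)}{\mathtt P^{(\mathrm{free})}_\Lambda(\mathrm N_\Lambda=N)},\qquad x,y\in\Lambda.$$ (This kernel does not come from a quantum-mechanical model.)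
   Formalization: In (ii) the O-constant is uniform in x,y only for ρ<ρ_c; at ρ=ρ_c it may depend on x,y, because there the uniform bound is false: the lower limit of the kernel is at least Σ_r g_{rβ}(x,y), which decays only like |x-y|^{2-d}. *)

(* Defs.v *)
From HB Require Import structures.
From mathcomp Require Import all_boot all_order all_algebra finmap.
From mathcomp Require Import all_classical all_reals all_analysis.

Set Implicit Arguments.
Unset Strict Implicit.
Unset Printing Implicit Defensive.

Import Order.TTheory GRing.Theory Num.Theory.
Import numFieldNormedType.Exports.

Local Open Scope classical_set_scope.
Local Open Scope ring_scope.

(* The canonical norm `|x| on 'rV[R]_d is the sup norm, hence this one. *)
Definition euclidean_norm (R : realType) (d : nat) (x : 'rV[R]_d) : R :=
  Num.sqrt (\sum_(i < d) x ord0 i ^+ 2).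

Definition unit_box (R : realType) (d : nat) : set 'rV[R]_d :=
  [set u | forall i, - 2^-1 <= u ord0 i <= 2^-1].

Definition centred_box (R : realType) (d : nat) (L : R) : set 'rV[R]_d :=
  [set L *: u | u in @unit_box R d].

(* the side length L_N with L_N ^ d = N / rho *)
Definition side (R : realType) (d : nat) (rho : R) (N : nat) : R :=
  (N%:R / rho) `^ (d%:R^-1).

Definition heat_kernel (R : realType) (d : nat) (t : R) (x y : 'rV[R]_d) : R :=
  (2 * pi * t) `^ (- (d%:R / 2))
  * expR (- (euclidean_norm (x - y) ^+ 2 / (2 * t))).

(* A real limit: the series converges exactly when d >= 3 (for beta > 0). *)
Definition rho_c (R : realType) (d : nat) (beta : R) : R :=
  limn (fun n : nat =>
    \sum_(1 <= k < n.+1) (2 * pi * beta * k%:R) `^ (- (d%:R / 2))).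

(* mutual independence of the subfamily of X indexed by D *)
Definition independent_RVs (R : realType) (dO dT : measure_display)
    (Omega : measurableType dO) (T : measurableType dT)
    (P : probability Omega R) (D : set nat) (X : nat -> {mfun Omega >-> T}) :=
  forall (J : {fset nat}) (A : nat -> set T),
    [set` J] `<=` D -> (forall k, measurable (A k)) ->
    P (\bigcap_(k in [set` J]) (X k @^-1` A k))
    = (\prod_(k <- J) P (X k @^-1` A k))%E.

(* For the box of side L one has \int_Lambda g_(k beta)(x, x) dx
   = L ^ d * (2 pi beta k) ^ (- d / 2).  Only the indices k >= 1 matter. *)
Definition free_cycle_law (R : realType) (dO : measure_display)
    (Omega : measurableType dO) (d : nat) (beta L : R)
    (P : probability Omega R) (X : nat -> {mfun Omega >-> nat}) :=
  independent_RVs P [set k | (0 < k)%N] X /\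
  forall k j : nat, (0 < k)%N ->
    P (X k @^-1` [set j]) =
    (poisson_pmf
       (k%:R^-1 * (L ^+ d * (2 * pi * beta * k%:R) `^ (- (d%:R / 2)))) j)%:E.

Definition total_number (R : realType) (dO : measure_display)
    (Omega : measurableType dO) (X : nat -> {mfun Omega >-> nat})
    (w : Omega) : \bar R :=
  (\sum_(1 <= k <oo) ((k * X k w)%:R : R)%:E)%E.

Definition prob_total (R : realType) (dO : measure_display)
    (Omega : measurableType dO) (P : probability Omega R)
    (X : nat -> {mfun Omega >-> nat}) (n : nat) : R :=
  fine (P [set w | total_number R X w = (n%:R : R)%:E]).

Definition gamma_free (R : realType) (dO : measure_display)
    (Omega : measurableType dO) (P : probability Omega R)
    (X : nat -> {mfun Omega >-> nat}) (d : nat) (beta : R) (N : nat)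
    (x y : 'rV[R]_d) : R :=
  \sum_(1 <= r < N.+1)
    heat_kernel (r%:R * beta) x y
    * (prob_total P X (N - r)%N / prob_total P X N).

(* Main.v *)
Require Import Defs.
From HB Require Import structures.
From mathcomp Require Import all_boot all_order all_algebra finmap.
From mathcomp Require Import all_classical all_reals all_analysis.
From mathcomp Require Import ring lra zify.

Set Implicit Arguments.
Unset Strict Implicit.
Unset Printing Implicit Defensive.

Import Order.TTheory GRing.Theory Num.Theory.
Import numFieldNormedType.Exports.

Local Open Scope classical_set_scope.
Local Open Scope ring_scope.

(** Write [V = N / rho] for the volume of the box, [a_r] for the weight
    [(2 pi beta r)^(-d/2)], [p_n] for the probability that the total number
    is [n], and [q_r = p_(N-r) / p_N].  The kernel is
      [gamma_N(x, y) = sum_(1 <= r <= N) a_r exp(-|x-y|^2 / (2 beta r)) q_r].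
    Independence and the Poisson laws enter only through the recursion
      [n p_n = V sum_(1 <= r <= n) a_r p_(n-r)]
    ([prob_total_rec], [free_gas_recursion]).  At [n = N] it says that the
    kernel equals [rho] on the diagonal ([diagonal_density]), so that
    [0 <= gamma_N <= rho] everywhere.  This already gives the bound for fixed
    [x, y] when [rho <= rho_c]; the rest depends on the size of [q_r].

    Subcritical regime, [rho < rho_c].  Let [z_n = p_(n-1) / p_n], with
    [z_0 = 0].  Subtracting the recursion at two consecutive indices gives
      [sum_(1 <= r <= n) a_r p_(n-r) (z_n - z_(n-r)) = p_(n-1) / V].
    As [a] is nonincreasing, comparing this identity at [n] and [n+1] shows
    that [z] is nondecreasing as long as it is at most [1]; then every term is
    nonnegative, and the term [r = 1] shows that [z] grows by at most
    [1 / (a_1 V)] per step.  Thus [z] is nearly constant over any fixed number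
    of steps, and if [z_n] were close to [1] with [n <= rho V], the recursion
    would force [n / V] above [rho].  Hence [z_n <= z < 1] for all
    [n <= rho V] and [q_r <= z^r] ([subcritical_prob_ratio]); the inequality
    of arithmetic and geometric means turns
    [z^r exp(-|x-y|^2 / (2 beta r))] into [exp(-c |x-y|)].

    Supercritical regime, [rho > rho_c].  Normalize [p] to have sum [1] on
    [0, N].  For [n > rho_1 V] with [rho_1 > rho_c], the recursion expresses
    [p_n] through the [p_(n-r)] with [r <= m], with coefficients of total mass
    at most [rho_c / rho_1 < 1], up to an error of order [m^(-d/2)].  The
    contraction lemma [power_contraction] yields [p_n = O(V^(-d/2))] at
    macroscopic distance above [rho_1 V].  The same lemma applied to the
    increments yields [p_n - p_(n-1) = O(V^(-d/2-1))].  Bounding every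
    [a_r] below by [a_N] gives [p_N >= const N^(-d/2)].  Together,
    [|q_r - 1| <= C r / N] for [r <= eps N] ([supercritical_prob_ratio]).
    The loops with [r <= eps N] therefore contribute
    [psi(|x-y|) = sum_r a_r exp(-|x-y|^2 / (2 beta r))] in the limit, and for
    those with [r > eps N] the Gaussian factor tends to [1] uniformly, because
    [|x-y|^2 = O(N^(2/d))] and [d >= 3]; by the diagonal identity they carry
    the remaining mass [rho - rho_c]. *)

(** * Laws of weighted sums of independent Poisson variables *)

(** The law of [sum_(1 <= k <= m) k Y_k] at [n], for independent Poisson
    variables [Y_k] of parameter [lam k], by convolution over the value [j] of
    the last variable. *)
Fixpoint cycle_pmf (R : realType) (lam : nat -> R) (m n : nat) : R :=
  if m is q.+1 then
    \sum_(0 <= j < n.+1 | (m * j <= n)%N)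
      poisson_pmf (lam m) j * cycle_pmf lam q (n - m * j)
  else (n == 0%N)%:R.

(** The range of [j] may be extended freely, as [m.+1 * j <= n] bounds [j]. *)
Lemma cycle_pmfE (R : realType) (lam : nat -> R) (m n B : nat) :
  (n < B)%N ->
  cycle_pmf lam m.+1 n = \sum_(0 <= j < B | (m.+1 * j <= n)%N)
      poisson_pmf (lam m.+1) j * cycle_pmf lam m (n - m.+1 * j).
Proof.
move=> nB; rewrite /= [RHS](big_cat_nat _ (n := n.+1))//=.
rewrite [X in _ + X]big_nat_cond [X in _ + X]big1 ?addr0// => j.
by move=> /andP[/andP[nj _] jn]; exfalso; nia.
Qed.

Arguments cycle_pmf : simpl never.

Lemma poisson_pmfS (R : realType) (l : R) (j : nat) : 0 < l ->
  j.+1%:R * poisson_pmf l j.+1 = l * poisson_pmf l j.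
Proof.
move=> l0; rewrite /poisson_pmf l0 exprS factS natrM.
by field; rewrite !pnatr_eq0 -lt0n fact_gt0 andTb.
Qed.

(** The compound Poisson recursion.  It is proved by induction on [m]: in the
    convolution write [n = q j + (n - q j)] with [q = m.+1], use
    [poisson_pmfS] on the first part and the induction hypothesis on the
    second one. *)
Lemma cycle_pmf_rec (R : realType) (lam : nat -> R) (m n : nat) :
  (forall k, (0 < k)%N -> 0 < lam k) ->
  n%:R * cycle_pmf lam m n =
  \sum_(1 <= k < m.+1 | (k <= n)%N) k%:R * lam k * cycle_pmf lam m (n - k).
Proof.
move=> lam0; elim: m n => [|m IH] n.
  by rewrite big_geq// /cycle_pmf; case: n => [|n]; rewrite ?mul0r ?mulr0.
set q := m.+1.
pose pi j := poisson_pmf (lam q) j.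
have split_n : n%:R * cycle_pmf lam q n =
    \sum_(0 <= j < n.+1 | (q * j <= n)%N)
       q%:R * (j%:R * pi j) * cycle_pmf lam m (n - q * j)
  + \sum_(0 <= j < n.+1 | (q * j <= n)%N)
       pi j * ((n - q * j)%:R * cycle_pmf lam m (n - q * j)).
  rewrite -big_split /= (@cycle_pmfE _ _ _ _ n.+1)// mulr_sumr.
  apply: eq_bigr => j qjn.
  rewrite natrB// natrM -/q -/(pi j).
  move: (cycle_pmf _ _ _) (q%:R : R) => c u; ring.
rewrite split_n [RHS]big_mkcond/= [RHS]big_nat_recr//= [LHS]addrC.
congr (_ + _); last rewrite [LHS]big_mkcond /=.
  under eq_bigr do rewrite IH mulr_sumr.
  rewrite big_mkcond /=.
  under eq_bigr => j _ do rewrite [X in if _ then X else _]big_mkcond/=.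
  transitivity (\sum_(0 <= j < n.+1) \sum_(1 <= k < q)
     if (q * j <= n)%N && (k <= n - q * j)%N then
       pi j * (k%:R * lam k * cycle_pmf lam m (n - q * j - k)) else 0).
    apply: eq_bigr => j _; case: ifP => //= _; by rewrite big1.
  rewrite exchange_big/=; apply: eq_big_nat => k /andP[k1 kq].
  case: ifPn => kn; last first.
    rewrite big1// => j _; case: ifP => // /andP[a b]; exfalso; lia.
  rewrite (@cycle_pmfE _ _ _ _ n.+1); last by lia.
  rewrite mulr_sumr [RHS]big_mkcond/=; apply: eq_bigr => j _.
  have -> : (q * j <= n)%N && (k <= n - q * j)%N = (m.+1 * j <= n - k)%N.
    by rewrite -/q; apply/idP/idP => [/andP[]|]; lia.
  case: ifP => // _; rewrite -/q /pi.
  have -> : (n - q * j - k = n - k - q * j)%N by lia.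
  ring.
rewrite big_nat_recl// muln0 leq0n mul0r mulr0 mul0r add0r.
case: ifPn => qn; last first.
  rewrite big1// => j _; case: ifP => // H; exfalso; nia.
rewrite (@cycle_pmfE _ _ _ _ n); last by rewrite /q; lia.
rewrite mulr_sumr [RHS]big_mkcond/=; apply: eq_bigr => j _.
rewrite -/q mulnS.
have -> : (q + q * j <= n)%N = (q * j <= n - q)%N by apply/idP/idP; lia.
case: ifP => // _; rewrite /pi poisson_pmfS ?lam0// subnDA; ring.
Qed.

Lemma cycle_pmf_ge0 (R : realType) (lam : nat -> R) (m n : nat) :
  0 <= cycle_pmf lam m n.
Proof.
elim: m n => [|m IH] n; first by rewrite /cycle_pmf ler0n.
rewrite (@cycle_pmfE _ _ _ _ n.+1)//; apply: sumr_ge0 => j _.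
by rewrite mulr_ge0 ?poisson_pmf_ge0.
Qed.

Lemma cycle_pmf0 (R : realType) (lam : nat -> R) (m : nat) :
  (forall k, (0 < k)%N -> 0 < lam k) ->
  cycle_pmf lam m 0 = expR (- \sum_(1 <= k < m.+1) lam k).
Proof.
move=> lam0; elim: m => [|m IH]; first by rewrite big_geq// oppr0 expR0.
rewrite (@cycle_pmfE _ _ _ _ 1)// big_mkcond/= big_nat1 muln0 leqnn IH.
rewrite [in RHS]big_nat_recr//= opprD expRD mulrC; congr (_ * _).
by rewrite /poisson_pmf lam0// expr0 fact0 invr1 !mul1r.
Qed.

(** * The law of the partial particle numbers *)

(** The number of particles in cycles of length at most [m]. *)
Definition partial_number (dO : measure_display) (Omega : measurableType dO)
    (X : nat -> {mfun Omega >-> nat}) (m : nat) (w : Omega) : nat :=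
  (\sum_(1 <= k < m.+1) k * X k w)%N.

Lemma partial_numberS (dO : measure_display) (Omega : measurableType dO)
    (X : nat -> {mfun Omega >-> nat}) (m : nat) (w : Omega) :
  partial_number X m.+1 w = (partial_number X m w + m.+1 * X m.+1 w)%N.
Proof. by rewrite /partial_number big_nat_recr. Qed.

(** Decomposition of an event on [partial_number] according to the value [j] of
    the last variable. *)
Lemma partial_number_split (dO : measure_display) (Omega : measurableType dO)
    (X : nat -> {mfun Omega >-> nat}) (m n : nat) :
  [set w | partial_number X m.+1 w = n] =
  \big[setU/set0]_(j < n.+1)
    (if (m.+1 * j <= n)%N then
       [set w | partial_number X m w = (n - m.+1 * j)%N]
         `&` X m.+1 @^-1` [set nat_of_ord j]
     else set0).
Proof.
rewrite -bigcup_seq; apply/seteqP; split=> [w /=|w [j /= _]].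
  rewrite partial_numberS => E.
  have jn : (X m.+1 w < n.+1)%N by nia.
  exists (Ordinal jn) => /=; first by rewrite mem_index_enum.
  by rewrite ifT /=; [split=> //; lia|lia].
case: ifP => // jn [/= S0 Xj]; rewrite partial_numberS S0 Xj; lia.
Qed.

Lemma measurable_partial_number (dO : measure_display)
    (Omega : measurableType dO) (X : nat -> {mfun Omega >-> nat}) (m n : nat) :
  measurable [set w | partial_number X m w = n].
Proof.
elim: m n => [|m IH] n.
  have -> : [set w | partial_number X 0 w = n] = [set w | (0 = n)%N].
    by apply/seteqP; split=> w /=; rewrite /partial_number big_geq.
  case: n => [|n]; last by rewrite (_ : mkset _ = set0)//; apply/seteqP; split.
  by rewrite (_ : mkset _ = setT)//; apply/seteqP; split.
rewrite partial_number_split; apply: bigsetU_measurable => j _.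
case: ifP => // _; apply: measurableI => //; exact: measurable_funPTI.
Qed.

(** The partial number up to [m] has law [cycle_pmf lam m] and is independent of
    events on finitely many of the later variables.  The latter events are
    included in the statement so that the induction on [m] goes through: the
    event [X m.+1 = j] joins them. *)
Lemma prob_partial_number (R : realType) (dO : measure_display)
    (Omega : measurableType dO) (P : probability Omega R)
    (X : nat -> {mfun Omega >-> nat}) (lam : nat -> R) :
  independent_RVs P [set k | (0 < k)%N] X ->
  (forall k j, (0 < k)%N ->
     P (X k @^-1` [set j]) = (poisson_pmf (lam k) j)%:E) ->
  forall m n (J : {fset nat}) (A : nat -> set nat),
    (forall k, k \in J -> (m < k)%N) ->
    P ([set w | partial_number X m w = n]
         `&` \bigcap_(k in [set` J]) X k @^-1` A k)
    = ((cycle_pmf lam m n)%:E * P (\bigcap_(k in [set` J]) X k @^-1` A k))%E.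
Proof.
move=> indep law; elim=> [|m IH] n J A Jm.
  rewrite /cycle_pmf; case: n => [|n].
    rewrite mul1e; congr (P _); apply/seteqP; split=> w /=; first by case.
    by split=> //; rewrite /partial_number big_geq.
  rewrite mul0e (_ : _ `&` _ = set0) ?measure0//.
  by apply/seteqP; split=> w //= []; rewrite /partial_number big_geq.
set q := m.+1; set B := bigcap _ _.
have mB : measurable B.
  apply: fin_bigcap_measurable; first exact: finite_fset.
  by move=> i _; exact: measurable_funPTI.
pose F (j : nat) : set Omega := if (q * j <= n)%N then
   [set w | partial_number X m w = (n - q * j)%N]
     `&` X q @^-1` [set j] `&` B else set0.
have -> : [set w | partial_number X q w = n] `&` B =
    \big[setU/set0]_(j < n.+1) F j.
  rewrite partial_number_split big_distrl/=; apply: eq_bigr => j _.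
  by rewrite /F; case: ifP => // _; rewrite set0I.
have mF j : measurable (F j).
  rewrite /F; case: ifP => // _; apply: measurableI => //.
  by apply: measurableI; [exact: measurable_partial_number|
                          exact: measurable_funPTI].
rewrite measure_bigsetU//=; last first.
  move=> i j _ _ [w []]; rewrite /F; case: ifP => // _ [[_ /= Xi] _].
  by case: ifP => // _ [[_ /= Xj] _]; rewrite -Xi -Xj.
have PF j : P (F j) = ((if (q * j <= n)%N then
    poisson_pmf (lam q) j * cycle_pmf lam m (n - q * j) else 0)%:E * P B)%E.
  rewrite /F; case: ifP => jn; last by rewrite measure0 mul0e.
  pose A' k := if k == q then [set j] else A k.
  have qJ : q \notin J by apply/negP => /Jm; rewrite ltnn.
  have A'J k : k \in J -> A' k = A k.
    by rewrite /A'; case: eqP => // -> /Jm; rewrite ltnn.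
  have capE : X q @^-1` [set j] `&` B =
      \bigcap_(k in [set` (q |` J)%fset]) X k @^-1` A' k.
    rewrite set_fsetU1 bigcap_setU1 /A' eqxx; congr (_ `&` _).
    by apply: eq_bigcapr => k /= kJ; rewrite -/(A' k) A'J.
  rewrite -setIA capE IH; last first.
    by move=> k; rewrite !inE => /orP[/eqP ->//|/Jm]; apply: leq_trans.
  rewrite indep//; last first.
    by move=> k /=; rewrite !inE => /orP[/eqP ->//|/Jm]; apply: leq_trans.
  rewrite big_fsetU1//= /A' eqxx law// -/B [in RHS]/B indep//; last first.
    by move=> k /= /Jm; apply: leq_trans.
  rewrite muleA -EFinM mulrC; congr (_ * _)%E.
  by apply: eq_big_seq => k kJ; rewrite -/(A' k) A'J.
rewrite (eq_bigr _ (fun (j : 'I_n.+1) _ => PF j)).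
rewrite (@cycle_pmfE _ _ _ _ n.+1)// [in RHS]big_mkcond/= big_mkord -sumEFin.
rewrite [RHS]ge0_sume_distrl// => j _; rewrite lee_fin; case: ifP => // _.
by rewrite mulr_ge0 ?poisson_pmf_ge0 ?cycle_pmf_ge0.
Qed.

Lemma prob_partial_numberE (R : realType) (dO : measure_display)
    (Omega : measurableType dO) (P : probability Omega R)
    (X : nat -> {mfun Omega >-> nat}) (lam : nat -> R) :
  independent_RVs P [set k | (0 < k)%N] X ->
  (forall k j, (0 < k)%N ->
     P (X k @^-1` [set j]) = (poisson_pmf (lam k) j)%:E) ->
  forall m n,
    P [set w | partial_number X m w = n] = (cycle_pmf lam m n)%:E.
Proof.
move=> indep law m n.
have := @prob_partial_number _ _ _ P X lam indep law m n fset0 (fun=> setT).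
rewrite set_fset0 bigcap_set0 setIT probability_setT mule1; exact.
Qed.

(** * The law of the total particle number *)

Lemma total_number_const (R : realType) (dO : measure_display)
    (Omega : measurableType dO) (X : nat -> {mfun Omega >-> nat})
    (w : Omega) (n s : nat) :
  (forall m, (n <= m)%N -> partial_number X m w = s) ->
  total_number R X w = (s%:R : R)%:E.
Proof.
move=> S_s; apply: lim_near_cst => //; exists n.+1 => // -[//|m] /= nm.
by rewrite sumEFin -natr_sum -/(partial_number X m w) S_s.
Qed.

(** If the total is [n], no cycle is longer than [n], so the partial numbers
    are constant from [n] on. *)
Lemma total_numberP (R : realType) (dO : measure_display)
    (Omega : measurableType dO) (X : nat -> {mfun Omega >-> nat})
    (w : Omega) (n : nat) :
  total_number R X w = (n%:R : R)%:E <->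
  forall m, (n <= m)%N -> partial_number X m w = n.
Proof.
split=> [Tn|]; last exact: total_number_const.
have S_le m : (partial_number X m w <= n)%N.
  rewrite -(ler_nat R) -lee_fin -Tn /total_number.
  rewrite /partial_number natr_sum -sumEFin.
  by apply: nneseries_lim_ge => k _ _; rewrite lee_fin.
have X0 k : (n < k)%N -> X k w = 0%N.
  case: k => // k nk; have := S_le k.+1; rewrite partial_numberS; nia.
have S_n m : (n <= m)%N -> partial_number X m w = partial_number X n w.
  move=> /subnKC <-; elim: (m - n)%N => [|j IH]; first by rewrite addn0.
  by rewrite addnS partial_numberS IH X0 ?muln0 ?addn0// ltnS leq_addr.
have := total_number_const R S_n; rewrite Tn => -[/eqP].
by rewrite eqr_nat => /eqP nS m nm; rewrite S_n.
Qed.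

(** From [n] on the events that the partial number equals [n] decrease, with
    intersection the event that the total number equals [n]. *)
Lemma prob_total_cvg (R : realType) (dO : measure_display)
    (Omega : measurableType dO) (P : probability Omega R)
    (X : nat -> {mfun Omega >-> nat}) (lam : nat -> R) :
  independent_RVs P [set k | (0 < k)%N] X ->
  (forall k j, (0 < k)%N ->
     P (X k @^-1` [set j]) = (poisson_pmf (lam k) j)%:E) ->
  forall n, cycle_pmf lam m n @[m --> \oo] --> prob_total P X n.
Proof.
move=> indep law n.
have -> : prob_total P X n =
    fine (P (\bigcap_m [set w | partial_number X (m + n) w = n])).
  congr (fine (P _)); apply/seteqP; split=> w /=.
    by move=> /total_numberP S_n m _; rewrite /= S_n ?leq_addl.
  move=> S_n; apply/total_numberP => m nm.
  by have := S_n (m - n)%N I; rewrite /= subnK.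
have mS m : measurable [set w | partial_number X (m + n) w = n].
  exact: measurable_partial_number.
have mcap : measurable (\bigcap_m [set w | partial_number X (m + n) w = n]).
  by apply: bigcap_measurable; [exists 0%N|move=> k _].
rewrite -(cvg_shiftn n).
have -> : (fun m => cycle_pmf lam (m + n) n) =
    fine \o (P \o (fun m => [set w | partial_number X (m + n) w = n])).
  by apply/funext => m /=; rewrite (prob_partial_numberE indep law).
apply: fine_cvg; rewrite fineK ?fin_num_measure//.
apply: nonincreasing_cvg_mu => //.
  by rewrite -ge0_fin_numE// fin_num_measure.
apply/nonincreasing_seqP => m; apply/subsetPset => w /=.
rewrite addSn partial_numberS => S_n.
by case: (X (m + n).+1 w) S_n => [|j]; [rewrite muln0 addn0|rewrite mulnS; lia].
Qed.

Lemma prob_total_rec (R : realType) (dO : measure_display)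
    (Omega : measurableType dO) (P : probability Omega R)
    (X : nat -> {mfun Omega >-> nat}) (lam : nat -> R) :
  (forall k, (0 < k)%N -> 0 < lam k) ->
  independent_RVs P [set k | (0 < k)%N] X ->
  (forall k j, (0 < k)%N ->
     P (X k @^-1` [set j]) = (poisson_pmf (lam k) j)%:E) ->
  forall n, n%:R * prob_total P X n =
    \sum_(1 <= k < n.+1) k%:R * lam k * prob_total P X (n - k).
Proof.
move=> lam0 indep law n; have cvgp := prob_total_cvg indep law.
have L1 : n%:R * cycle_pmf lam m n @[m --> \oo] --> n%:R * prob_total P X n.
  by apply: cvgMr; exact: cvgp.
have L2 : \sum_(1 <= k < n.+1) k%:R * lam k * cycle_pmf lam m (n - k)
    @[m --> \oo] --> \sum_(1 <= k < n.+1) k%:R * lam k * prob_total P X (n - k).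
  by apply: cvg_big => [|k _]; [exact: add_continuous|]; apply: cvgMr; exact: cvgp.
apply: (cvg_unique _ L1) => //.
apply: cvg_trans L2; apply: near_eq_cvg; exists n => // m /= nm.
rewrite cycle_pmf_rec// (big_cat_nat _ (n := n.+1) (p := m.+1))//=.
rewrite [X in _ + X]big_nat_cond [X in _ + X]big1 ?addr0; last first.
  by move=> k /andP[/andP[]]; lia.
rewrite big_nat_cond [RHS]big_nat_cond; apply: eq_bigl => k; lia.
Qed.

Lemma prob_total_gt0 (R : realType) (dO : measure_display)
    (Omega : measurableType dO) (P : probability Omega R)
    (X : nat -> {mfun Omega >-> nat}) (lam : nat -> R) (s : R) :
  (forall k, (0 < k)%N -> 0 < lam k) ->
  (forall m, \sum_(1 <= k < m.+1) lam k <= s) ->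
  independent_RVs P [set k | (0 < k)%N] X ->
  (forall k j, (0 < k)%N ->
     P (X k @^-1` [set j]) = (poisson_pmf (lam k) j)%:E) ->
  forall n, 0 < prob_total P X n.
Proof.
move=> lam0 lams indep law.
have p0 : 0 < prob_total P X 0.
  apply: (lt_le_trans (expR_gt0 (- s))).
  apply: (cvgr_to_ge (prob_total_cvg indep law (n := 0%N))).
  by apply: nearW => m; rewrite cycle_pmf0// ler_expR lerN2.
elim/ltn_ind=> -[//|n] IH.
have n0 : 0 < n.+1%:R :> R by rewrite ltr0n.
rewrite -(pmulr_rgt0 _ n0) (prob_total_rec lam0 indep law) big_nat_recl//.
apply: ltr_wpDr; last by rewrite mul1r mulr_gt0 ?lam0// IH// subSS subn0.
rewrite big_nat_cond; apply: sumr_ge0 => k; rewrite andbT => /andP[_ kn].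
by rewrite mulr_ge0 ?ltW// ?IH// ?mulr_gt0 ?lam0//; lia.
Qed.

(** * Probability ratios below the critical density *)

Lemma bernoulli_le (R : realFieldType) (t : R) (n : nat) :
  0 <= t <= 1 -> 1 - n%:R * t <= (1 - t) ^+ n.
Proof.
move=> /andP[t0 t1]; elim: n => [|n IH]; first by rewrite mul0r subr0 expr0.
rewrite exprS -natr1.
have : (1 - t) * (1 - n%:R * t) <= (1 - t) * (1 - t) ^+ n.
  by rewrite ler_wpM2l// subr_ge0.
have : 0 <= n%:R * (t * t) by rewrite !mulr_ge0.
lra.
Qed.

(** The recursion satisfied by the law [p] of the particle number in volume
    [V], for loop weights [a]; it is linear in [p], so it does not see the
    normalization of [p]. *)
Definition cycle_recursion (R : realType) (V : R) (a p : nat -> R) : Prop :=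
  forall n, n%:R * p n = V * \sum_(1 <= r < n.+1) a r * p (n - r)%N.

(** The ratio [p_(n-1) / p_n], with the convention that it vanishes at [0]. *)
Definition prev_ratio (R : realType) (p : nat -> R) (n : nat) : R :=
  if n is m.+1 then p m / p n else 0.

Lemma prev_ratioE (R : realType) (p : nat -> R) (n : nat) :
  (forall k, 0 < p k) -> prev_ratio p n.+1 * p n.+1 = p n.
Proof. by move=> p0; rewrite /= divfK// gt_eqF. Qed.

(** The difference of the recursions at [n.+1] and [n], in terms of ratios.
    The term [r = n.+1] is accounted for by [prev_ratio p 0 = 0]. *)
Lemma prev_ratio_identity (R : realType) (V : R) (a p : nat -> R) (n : nat) :
  0 < V -> (forall k, 0 < p k) -> cycle_recursion V a p ->
  \sum_(1 <= r < n.+2) a r * p (n.+1 - r)%N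
     * (prev_ratio p n.+1 - prev_ratio p (n.+1 - r)) = p n / V.
Proof.
move=> V0 p0 rec.
have sum1 : \sum_(1 <= r < n.+2) a r * p (n.+1 - r)%N * prev_ratio p n.+1
    = n.+1%:R * p n / V.
  rewrite -mulr_suml -(prev_ratioE n p0) (mulrC _ (p n.+1)) !mulrA rec; field.
  by rewrite !gt_eqF.
have sum2 : \sum_(1 <= r < n.+2) a r * p (n.+1 - r)%N * prev_ratio p (n.+1 - r)
    = n%:R * p n / V.
  rewrite big_nat_recr//= subnn mulr0 addr0 rec mulrAC divff ?gt_eqF// mul1r.
  apply: eq_big_nat => r /andP[_ rn].
  by rewrite subSn// -mulrA (mulrC (p _)) prev_ratioE.
under eq_bigr do rewrite mulrBr.
by rewrite sumrB sum1 sum2 -mulrBl -mulrBl -natrB// subSnn mul1r.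
Qed.

(** The ratios keep increasing as long as they do not exceed [1].  The
    identity for [z_n] bounds the left side of the identity for [z_(n+1)] with
    [z_n] in place of [z_(n+1)]: shift [r] by one and use [a_(r+1) <= a_r]. *)
Lemma prev_ratio_nondecreasing_step (R : realType) (V : R) (a p : nat -> R)
    (n : nat) :
  0 < V -> (forall k, 0 < p k) -> (forall k, (0 < k)%N -> 0 < a k) ->
  (forall k, (0 < k)%N -> a k.+1 <= a k) -> cycle_recursion V a p ->
  (forall k, (k <= n)%N -> prev_ratio p k <= prev_ratio p n) ->
  prev_ratio p n <= 1 -> prev_ratio p n <= prev_ratio p n.+1.
Proof.
move=> V0 p0 a0 a_dec rec mono le1.
case: n => [|n] in mono le1 *; first by rewrite /= ltW// divr_gt0.
set z := prev_ratio p in mono le1 *.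
have J1 := prev_ratio_identity n V0 p0 rec.
have J2 := prev_ratio_identity n.+1 V0 p0 rec.
have cmp : \sum_(1 <= r < n.+3) a r * p (n.+2 - r)%N * (z n.+1 - z (n.+2 - r)%N)
    <= p n.+1 / V.
  apply: (@le_trans _ _ (p n / V)); last first.
    rewrite ler_pM2r ?invr_gt0// -(prev_ratioE n p0).
    by rewrite ler_piMl// ltW.
  rewrite -J1 big_nat_recl//= subSS subn0 subrr mulr0 add0r.
  apply: ler_sum_nat => r /andP[r1 rn]; rewrite subSS.
  apply: ler_wpM2r; first by rewrite subr_ge0 mono// leq_subr.
  by rewrite ler_pM2r// a_dec.
move: cmp; rewrite -J2 -subr_ge0 -sumrB.
under eq_bigr do rewrite -mulrBr opprB addrA subrK.
rewrite -mulr_suml pmulr_rge0 ?subr_ge0//.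
rewrite big_nat_recl// ltr_wpDr ?mulr_gt0 ?a0//.
rewrite big_nat_cond; apply: sumr_ge0 => r /andP[_ _].
by rewrite ltW// mulr_gt0// a0.
Qed.

(** The term [r = 1] of [prev_ratio_identity], all other terms being
    nonnegative. *)
Lemma prev_ratio_increment_le (R : realType) (V : R) (a p : nat -> R) (n : nat) :
  0 < V -> (forall k, 0 < p k) -> (forall k, (0 < k)%N -> 0 < a k) ->
  cycle_recursion V a p ->
  (forall k, (k <= n)%N -> prev_ratio p k <= prev_ratio p n.+1) ->
  prev_ratio p n.+1 - prev_ratio p n <= (a 1 * V)^-1.
Proof.
move=> V0 p0 a0 rec mono; have := prev_ratio_identity n V0 p0 rec.
rewrite big_nat_recl//= subSS subn0 => J.
have : a 1 * p n * (prev_ratio p n.+1 - prev_ratio p n) <= p n / V.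
  rewrite -J lerDl big_nat_cond; apply: sumr_ge0 => r /andP[/andP[r1 rn] _].
  apply: mulr_ge0; first by rewrite ltW// mulr_gt0// a0//; lia.
  by rewrite subr_ge0 mono//; lia.
have a1 := a0 1%N isT; have ap0 : 0 < a 1%N * p n by rewrite mulr_gt0.
move=> H; rewrite -(ler_pM2l ap0); apply: le_trans H _.
by rewrite le_eqVlt; apply/orP; left; apply/eqP; field; rewrite !gt_eqF.
Qed.

(** The induction that keeps the ratios below [1 - t / 2] up to [rho V]: a ratio
    above this value would force the previous [M] ratios above [1 - t], and then
    the recursion would give [n > rho V]. *)
Lemma subcritical_ratio_bound (R : realType) (V rho t : R) (a p : nat -> R)
    (M : nat) :
  0 < V -> (forall k, 0 < p k) -> (forall k, (0 < k)%N -> 0 < a k) ->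
  (forall k, (0 < k)%N -> a k.+1 <= a k) -> cycle_recursion V a p ->
  0 < t < 1 -> rho < (1 - t) ^+ M * \sum_(1 <= r < M.+1) a r ->
  M%:R / (a 1 * V) <= t / 2 ->
  forall n, n%:R <= rho * V -> prev_ratio p n <= 1 - t / 2.
Proof.
move=> V0 p0 a0 a_dec rec /andP[t0 t1] rhoM MV.
set z := prev_ratio p; set e := (a 1 * V)^-1.
have e0 : 0 <= e by rewrite invr_ge0 ltW// mulr_gt0// a0.
suff main n : n%:R <= rho * V -> z n <= 1 - t / 2 /\
    (forall j, (j < n)%N -> z j <= z j.+1 <= z j + e) by move=> n /main[].
elim: n => [|n IH] nV; first by split => //=; lra.
have [zn zj] : z n <= 1 - t / 2 /\
    (forall j, (j < n)%N -> z j <= z j.+1 <= z j + e).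
  by apply: IH; apply: le_trans nV; rewrite ler_nat.
have mono k : (k <= n)%N -> z k <= z n.
  clear IH nV zn; elim: n zj => [|m IH] zj; first by rewrite leqn0 => /eqP ->.
  rewrite leq_eqVlt => /orP[/eqP ->//|km].
  apply: (@le_trans _ _ (z m)); last by have /andP[] := zj m (ltnSn m).
  by apply: IH => // j jm; apply: zj; rewrite ltnS ltnW.
have zn1 : z n <= z n.+1.
  apply: (prev_ratio_nondecreasing_step V0 p0 a0 a_dec rec mono).
  by apply: le_trans zn _; lra.
have zn2 : z n.+1 <= z n + e.
  rewrite -lerBlDl; apply: (prev_ratio_increment_le V0 p0 a0 rec) => k kn.
  exact: le_trans (mono k kn) zn1.
have zjS j : (j < n.+1)%N -> z j <= z j.+1 <= z j + e.
  by rewrite ltnS leq_eqVlt => /orP[/eqP ->|/zj//]; rewrite zn1 zn2.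
split; last exact: zjS.
rewrite leNgt; apply/negP => z_gt.
(* going back r steps costs at most r * e *)
have back r : (r <= n.+1)%N -> z n.+1 - r%:R * e <= z (n.+1 - r)%N.
  elim: r => [|r IHr] rn; first by rewrite mul0r subr0 subn0.
  have jn : (n.+1 - r.+1 < n.+1)%N by rewrite subSS ltnS leq_subr.
  have /andP[_] := zjS _ jn; rewrite -subSn// subSS => H.
  have := IHr (ltnW rn); rewrite -natr1 mulrDl mul1r; lra.
have Me : M%:R * e <= t / 2 by [].
have Mn : (M <= n.+1)%N.
  rewrite leqNgt; apply/negP => nM.
  have := back n.+1 (leqnn _); rewrite subnn /z [prev_ratio p 0]/= -/z.
  have : n.+1%:R * e <= M%:R * e by rewrite ler_wpM2r// ler_nat ltnW.
  lra.
have pr r : (r <= M)%N -> (1 - t) ^+ M * p n.+1 <= p (n.+1 - r)%N.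
  move=> rM; apply: (@le_trans _ _ ((1 - t) ^+ r * p n.+1)).
    rewrite ler_pM2r//; apply: ler_wiXn2l => //; lra.
  elim: r rM => [|r IHr] rM; first by rewrite expr0 mul1r subn0.
  have rn : (r < n.+1)%N by exact: leq_trans rM Mn.
  rewrite exprS -mulrA.
  have -> : p (n.+1 - r.+1)%N = z (n.+1 - r)%N * p (n.+1 - r)%N.
    by rewrite subSS subSn// prev_ratioE.
  apply: ler_pM; [lra|by rewrite mulr_ge0 ?exprn_ge0 ?ltW//; lra| |].
    have := back r (ltnW rn).
    have : r%:R * e <= M%:R * e by rewrite ler_wpM2r// ler_nat ltnW.
    lra.
  by apply: IHr; exact: ltnW.
have : rho * V * p n.+1 < n.+1%:R * p n.+1.
  rewrite rec (big_cat_nat _ (n := M.+1))//= mulrDr ltr_wpDr//.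
    rewrite mulr_ge0 ?(ltW V0)// big_nat_cond; apply: sumr_ge0 => r.
    move=> /andP[/andP[r1 _] _]; rewrite ltW// mulr_gt0// a0//.
    exact: leq_trans r1.
  apply: (@lt_le_trans _ _
    (V * ((1 - t) ^+ M * \sum_(1 <= r < M.+1) a r * p n.+1))).
    by rewrite (mulrC rho) -mulrA ltr_pM2l// -mulr_suml mulrA ltr_pM2r.
  rewrite ler_pM2l// mulr_sumr; apply: ler_sum_nat => r /andP[r1 rM].
  by rewrite mulrCA ler_pM2l ?a0// pr.
rewrite ltr_pM2r// => /lt_le_trans /(_ nV); by rewrite ltxx.
Qed.

Lemma subcritical_prob_ratio (R : realType) (a : nat -> R) (rho : R) (M : nat) :
  0 < rho -> (forall k, (0 < k)%N -> 0 < a k) ->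
  (forall k, (0 < k)%N -> a k.+1 <= a k) -> rho < \sum_(1 <= r < M.+1) a r ->
  exists z1 V0 : R, [/\ 0 < z1 < 1, 0 < V0 & forall (V : R) (p : nat -> R),
    V0 <= V -> (forall k, 0 < p k) -> cycle_recursion V a p ->
    forall n r, (r <= n)%N -> n%:R <= rho * V -> p (n - r)%N <= z1 ^+ r * p n].
Proof.
move=> rho0 a0 a_dec; set A := \sum_(_ <= _ < _) _ => rhoA.
have A0 : 0 < A by lra.
have a1 := a0 1%N isT.
pose u := rho / A.
have u1 : 0 < u < 1 by rewrite divr_gt0//= ltr_pdivrMr// mul1r.
(* [t] is small enough for Bernoulli's inequality to give [u < (1 - t) ^+ M]. *)
pose t := (1 - u) / (M%:R + 2).
have M2 : 0 < M%:R + 2 :> R by rewrite ltr_wpDl// ler0n.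
have tE : t * (M%:R + 2) = 1 - u by rewrite divfK// gt_eqF.
have t0 : 0 < t by rewrite divr_gt0//; lra.
have M0 : 0 <= M%:R :> R := ler0n _ _.
have tM0 : 0 <= t * M%:R by rewrite mulr_ge0// ltW.
have t1 : t < 1 by move: tE; rewrite mulrDr; lra.
exists (1 - t / 2), (1 + M%:R / (a 1%N * (t / 2))); split; first by lra.
  by rewrite ltr_pwDl// divr_ge0// mulr_ge0// ltW//; lra.
move=> V p V0V p0 rec n r rn nV.
have b0 : 0 < a 1%N * (t / 2) by rewrite mulr_gt0//; lra.
have V0 : 0 < V.
  by apply: lt_le_trans V0V; rewrite ltr_pwDl// divr_ge0// ltW.
have pow_gt : rho < (1 - t) ^+ M * A.
  rewrite -ltr_pdivrMr// -/u; apply: (@lt_le_trans _ _ (1 - M%:R * t)).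
    move: tE; rewrite mulrDr (mulrC t M%:R); lra.
  by apply: bernoulli_le; rewrite !ltW.
have MV : M%:R / (a 1%N * V) <= t / 2.
  have MV : M%:R / (a 1%N * (t / 2)) <= V by apply: le_trans V0V; rewrite lerDr.
  rewrite ler_pdivrMr ?mulr_gt0// mulrCA mulrA.
  by move: MV; rewrite ler_pdivrMr// mulrC.
have zle m : (m <= n)%N -> prev_ratio p m <= 1 - t / 2.
  move=> mn; apply: (subcritical_ratio_bound V0 p0 a0 a_dec rec _ pow_gt MV).
    by rewrite t0 t1.
  by apply: le_trans nV; rewrite ler_nat.
elim: r rn => [|r IH] rn; first by rewrite subn0 expr0 mul1r.
have -> : p (n - r.+1)%N = prev_ratio p (n - r) * p (n - r)%N.
  by rewrite -(subnSK rn) prev_ratioE.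
rewrite exprS -mulrA; apply: ler_pM; last exact/IH/ltnW.
- by rewrite -(subnSK rn) ltW// divr_gt0.
- exact: ltW.
- by apply: zle; exact: leq_subr.
Qed.

(** * Real powers and a contraction lemma *)

Lemma powR_bernoulli (R : realType) (h t : R) (D : nat) :
  h <= D%:R -> 0 <= t < 1 -> 1 - D%:R * t <= (1 - t) `^ h.
Proof.
move=> hD /andP[t0 t1].
have u0 : 0 < 1 - t by lra.
apply: (le_trans (bernoulli_le D _)); first by rewrite t0 ltW.
rewrite -powR_mulrn ?(ltW u0)//; apply: (ger_powR _ hD); rewrite u0 /=; lra.
Qed.

Lemma powRN_le (R : realType) (h x y : R) :
  0 <= h -> 0 < x -> x <= y -> y `^ (- h) <= x `^ (- h).
Proof.
move=> h0 x0 xy; have y0 : 0 < y := lt_le_trans x0 xy.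
rewrite !powRN lef_pV2 ?posrE ?powR_gt0//.
by apply: ge0_ler_powR => //; rewrite nnegrE ltW.
Qed.

Lemma powRNM (R : realType) (h x y : R) :
  0 < x -> 0 < y -> (x * y) `^ (- h) = x `^ (- h) * y `^ (- h).
Proof. by move=> x0 y0; rewrite powRM ?ltW. Qed.

Lemma powRND1 (R : realType) (h x : R) :
  0 < x -> x `^ (- (h + 1)) = x `^ (- h) / x.
Proof.
move=> x0; rewrite opprD powRD; last by apply/implyP => _; rewrite gt_eqF.
by rewrite powR_inv1// ltW.
Qed.

(** If [f n] is at most a weighted sum of the [m] previous values, of total
    weight at most [theta < 1], plus an error [C (m+1)^(-k)], for every
    [m < n - s], then [f n] decays like [(n - s)^(-k)], with a constant that
    does not depend on [f], [s], [N].  The proof takes [m] to be a small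
    fraction of [n - s], so that, for [r <= m], [(n - r - s)^(-k)] exceeds
    [(n - s)^(-k)] at most by a factor [g] with [theta * g < 1]. *)
Lemma power_contraction (R : realType) (k theta C : R) :
  0 < k -> 0 <= theta < 1 -> 0 < C ->
  exists2 B : R, 0 < B & forall (f : nat -> R) (b : nat -> nat -> R) (s N : nat),
    (forall n r, 0 <= b n r) ->
    (forall n m, (s < n <= N)%N -> (m < n - s)%N ->
       \sum_(1 <= r < m.+1) b n r <= theta) ->
    (forall n m, (s < n <= N)%N -> (m < n - s)%N ->
       f n <= \sum_(1 <= r < m.+1) b n r * f (n - r)%N
              + C * m.+1%:R `^ (- k)) ->
    forall n, (s < n <= N)%N -> f n <= B * (n - s)%:R `^ (- k).
Proof.
move=> k0 /andP[th0 th1] C0.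
pose D := (Num.truncn k).+1.
have kD : k <= D%:R by rewrite ltW// truncnS_gt.
(* [K] is so large that [theta (1 - 1/K)^(-k) <= (1 + theta) / 2]. *)
pose K := (Num.truncn (D%:R * (1 + theta) / (1 - theta))).+2.
have K0 : 0 < K%:R :> R by rewrite ltr0n.
have K2 : 2 <= K%:R :> R by rewrite ler_nat.
have DK : D%:R * (1 + theta) <= K%:R * (1 - theta).
  rewrite -ler_pdivrMr ?subr_gt0//; apply/ltW/(lt_le_trans (truncnS_gt _)).
  by rewrite ler_nat.
have iK : 0 <= (K%:R^-1 : R) < 1.
  by rewrite invr_ge0 ltW//= invf_lt1//; lra.
pose g : R := (1 - K%:R^-1) `^ (- k).
have g0 : 0 < g by rewrite powR_gt0//; lra.
have thg : theta * g <= (1 + theta) / 2.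
  rewrite /g powRN ler_pdivrMr ?powR_gt0//; last lra.
  have := powR_bernoulli kD iK.
  have : D%:R / K%:R * (1 + theta) <= 1 - theta :> R.
    by rewrite mulrAC ler_pdivrMr// (mulrC (1 - theta)).
  set u := _ `^ _; set v := D%:R / K%:R => Hv Hu.
  have : (1 + theta) / 2 * (1 - v) <= (1 + theta) / 2 * u.
    by rewrite ler_pM2l//; lra.
  nra.
(* [B] solves [(1 + theta) / 2 * B + C K^k = B]. *)
pose B : R := 2 * C * K%:R `^ k / (1 - theta).
have B0 : 0 < B by rewrite divr_gt0 ?mulr_gt0 ?powR_gt0 ?subr_gt0.
exists B => // f b s N b0 bth fN; elim/ltn_ind => n IH /andP[sn nN].
pose j := (n - s)%N; pose m := (j %/ K)%N.
have j0 : (0 < j)%N by rewrite subn_gt0.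
have jR : 0 < j%:R :> R by rewrite ltr0n.
have mj : (m < j)%N by rewrite ltn_Pdiv.
have mK : m%:R <= j%:R / K%:R :> R.
  by rewrite ler_pdivlMr// -natrM ler_nat leq_trunc_div.
have m1K : j%:R / K%:R <= m.+1%:R :> R.
  by rewrite ler_pdivrMr// -natrM ler_nat ltnW// ltn_ceil.
have bm := bth n m (introT andP (conj sn nN)) mj.
apply: (le_trans (fN n m _ mj)); first by rewrite sn.
have H1 : C * m.+1%:R `^ (- k) <= C * K%:R `^ k * j%:R `^ (- k).
  rewrite -mulrA ler_pM2l//.
  apply: (le_trans (powRN_le (ltW k0) _ m1K)); first exact: divr_gt0.
  have -> : K%:R `^ k = K%:R^-1 `^ (- k) :> R.
    by rewrite -powR_inv1 ?(ltW K0)// -powRrM mulrNN mul1r.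
  by rewrite powRNM ?invr_gt0// mulrC.
have H2 : \sum_(1 <= r < m.+1) b n r * f (n - r)%N
    <= theta * (B * (g * j%:R `^ (- k))).
  apply: (@le_trans _ _ (\sum_(1 <= r < m.+1) b n r * (B * (g * j%:R `^ (- k))))).
    apply: ler_sum_nat => r /andP[r1]; rewrite ltnS => rm.
    apply: ler_wpM2l => //.
    have rj : (r < n - s)%N by exact: leq_ltn_trans rm mj.
    have sr : (s < n - r)%N by rewrite ltn_subRL addnC -ltn_subRL.
    have nr : (n - r < n)%N by rewrite ltn_subrL r1 (leq_trans _ sn).
    apply: (le_trans (IH _ nr _)).
      by rewrite sr (leq_trans (ltnW nr)).
    rewrite ler_pM2l// /g -powRNM//; last lra.
    apply: powRN_le; [exact: ltW|by rewrite mulr_gt0//; lra|].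
    rewrite subnAC -/j [X in _ <= X]natrB; last exact: ltnW.
    have : r%:R <= m%:R :> R by rewrite ler_nat.
    rewrite mulrBl mul1r; move: mK; rewrite mulrC; lra.
  rewrite -mulr_suml; apply: ler_wpM2r => //.
  apply: mulr_ge0; first exact: ltW.
  by apply: mulr_ge0; [exact: ltW|exact: powR_ge0].
apply: (le_trans (lerD H2 H1)).
have -> : theta * (B * (g * j%:R `^ (- k))) + C * K%:R `^ k * j%:R `^ (- k)
   = (theta * g * B + C * K%:R `^ k) * j%:R `^ (- k) by ring.
rewrite ler_wpM2r ?powR_ge0//.
have BE : B * (1 - theta) = 2 * C * K%:R `^ k by rewrite divfK// gt_eqF// subr_gt0.
have : theta * g * B <= (1 + theta) / 2 * B by rewrite ler_pM2r.
lra.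
Qed.

(** * Local bounds above the critical density *)

Lemma sum_tail_rev_le (R : realType) (p : nat -> R) (m n N : nat) :
  (forall k, 0 <= p k) -> (n <= N)%N ->
  \sum_(m <= r < n.+1) p (n - r)%N <= \sum_(0 <= j < N.+1) p j.
Proof.
move=> p0 nN.
have [nm|mn] := ltnP n m; first by rewrite big_geq// sumr_ge0.
have -> : \sum_(0 <= j < N.+1) p j =
    \sum_(0 <= r < n.+1) p (n - r)%N + \sum_(n.+1 <= j < N.+1) p j.
  rewrite (big_cat_nat _ (n := n.+1))//=; congr (_ + _).
  by rewrite big_nat_rev/=; apply: eq_bigr => r _; rewrite add0n subSS.
rewrite [X in _ <= X + _](big_cat_nat _ (n := m))//=; last exact: leqW.
by rewrite -addrA addrCA lerDl addr_ge0// sumr_ge0.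
Qed.

(** Above [rho1 V], with [rho1] larger than the critical density, the recursion
    is a contraction: [V / n * Ac <= Ac / rho1 < 1].  Terms with [r > m] weigh
    at most [a_(m+1)] times the total mass of [p]. *)
Lemma prob_density_bound (R : realType) (h c Ac rho1 : R) :
  0 < h -> 0 < c -> 0 <= Ac < rho1 ->
  exists2 B : R, 0 < B & forall (V : R) (a p : nat -> R) (N s : nat),
    (forall r, a r = c * r%:R `^ (- h)) ->
    (forall m, \sum_(1 <= r < m.+1) a r <= Ac) ->
    0 < V -> (forall k, 0 < p k) -> cycle_recursion V a p ->
    \sum_(0 <= j < N.+1) p j <= 1 -> rho1 * V <= s.+1%:R ->
    forall n, (s < n <= N)%N -> p n <= B * (n - s)%:R `^ (- h).
Proof.
move=> h0 c0 /andP[Ac0 Ac1]; have r10 : 0 < rho1 by exact: le_lt_trans Ac1.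
have th : 0 <= Ac / rho1 < 1.
  by rewrite divr_ge0 ?(ltW r10)//= ltr_pdivrMr// mul1r.
have [B B0 contr] := power_contraction h0 th (divr_gt0 c0 r10).
exists B => // V a p N s aE aAc V0 p0 rec p1 rV.
have a0 r : 0 <= a r by rewrite aE mulr_ge0 ?powR_ge0// ltW.
have Vn n : (s < n)%N -> V / n%:R <= rho1^-1.
  move=> sn; have n0 : 0 < n%:R :> R by rewrite ltr0n (leq_trans _ sn).
  rewrite ler_pdivrMr// mulrC ler_pdivlMr// mulrC (le_trans rV)//.
  by rewrite ler_nat.
apply: (contr p (fun n r => V / n%:R * a r)).
- by move=> n r; rewrite mulr_ge0// divr_ge0// ltW.
- move=> n m /andP[sn _] _; rewrite -mulr_sumr mulrC.
  by apply: ler_pM => //; [exact: sumr_ge0|rewrite divr_ge0// ltW|exact: Vn].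
move=> n m /andP[sn nN] mn.
have n0 : 0 < n%:R :> R by rewrite ltr0n (leq_trans _ sn).
have mn1 : (m < n)%N by apply: leq_trans mn _; rewrite leq_subr.
have -> : p n = V / n%:R * \sum_(1 <= r < n.+1) a r * p (n - r)%N.
  by rewrite mulrAC -rec mulrAC divff ?gt_eqF// mul1r.
rewrite (big_cat_nat _ (n := m.+1))//=; last by rewrite ltnS ltnW.
rewrite mulrDr lerD//.
  by rewrite mulr_sumr le_eqVlt; apply/orP; left; apply/eqP;
     apply: eq_bigr => r _; rewrite mulrA.
have tail : \sum_(m.+1 <= r < n.+1) a r * p (n - r)%N <= c * m.+1%:R `^ (- h).
  apply: (@le_trans _ _
    (\sum_(m.+1 <= r < n.+1) c * m.+1%:R `^ (- h) * p (n - r)%N)).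
    apply: ler_sum_nat => r /andP[mr _]; rewrite ler_pM2r// aE ler_pM2l//.
    by apply: powRN_le; rewrite ?ltr0n ?ler_nat// ltW.
  rewrite -mulr_sumr ler_piMr ?mulr_ge0 ?powR_ge0 ?(ltW c0)//.
  by apply: le_trans p1; apply: sum_tail_rev_le => // k; exact: ltW.
rewrite (mulrC c) -[X in _ <= X]mulrA; apply: ler_pM => //; last exact: Vn.
  by rewrite divr_ge0// ltW.
by apply: sumr_ge0 => r _; rewrite mulr_ge0// ltW.
Qed.

(** The same contraction for the increments of [p].  Beyond [m] the shift by one
    is moved from [p] to [a], whose increments gain a factor [1 / m]; the
    boundary terms are products of two small factors, by the hypothesis that [p]
    is already of order [N^(-h)] above [s]. *)
Lemma prob_increment_bound (R : realType) (h c Ac rho2 E : R) (D : nat) :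
  1 <= h <= D%:R -> 0 < c -> 0 <= Ac < rho2 -> 0 < E ->
  exists2 B : R, 0 < B & forall (V : R) (a p : nat -> R) (N s : nat),
    (forall r, a r = c * r%:R `^ (- h)) ->
    (forall m, \sum_(1 <= r < m.+1) a r <= Ac) ->
    0 < V -> (forall k, 0 < p k) -> cycle_recursion V a p ->
    \sum_(0 <= j < N.+1) p j <= 1 -> rho2 * V <= s.+1%:R ->
    (forall j, (s <= j <= N)%N -> p j <= E * N%:R `^ (- h)) ->
    forall n, (s < n <= N)%N ->
      `|p n - p n.-1| <= B * (n - s)%:R `^ (- (h + 1)).
Proof.
move=> /andP[h1 hD] c0 /andP[Ac0 Ac1] E0.
have r20 : 0 < rho2 by exact: le_lt_trans Ac1.
have h0 : 0 < h by exact: lt_le_trans h1.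
have th : 0 <= Ac / rho2 < 1.
  by rewrite divr_ge0 ?(ltW r20)//= ltr_pdivrMr// mul1r.
(* The three summands bound, in this order, [p n / n.+1], the boundary term
   at [r = m.+1], and the sum over [r > m.+1]. *)
pose C := E + rho2^-1 * (c * E + D%:R * c).
have C0 : 0 < C.
  by rewrite ltr_wpDr// mulr_ge0 ?invr_ge0 ?(ltW r20)// addr_ge0// mulr_ge0// ltW.
have h10 : 0 < h + 1 by rewrite addr_gt0.
have [B B0 contr] := power_contraction h10 th C0.
exists B => // V a p N s aE aAc V0 p0 rec p1 rV pE.
have a0 r : 0 <= a r by rewrite aE mulr_ge0 ?powR_ge0// ltW.
have Vn n : (s < n)%N -> V / n%:R <= rho2^-1.
  move=> sn; have n0 : 0 < n%:R :> R by rewrite ltr0n (leq_trans _ sn).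
  rewrite ler_pdivrMr// mulrC ler_pdivlMr// mulrC (le_trans rV)//.
  by rewrite ler_nat.
apply: (contr (fun n => `|p n - p n.-1|) (fun n r => V / n%:R * a r)).
- by move=> n r; rewrite mulr_ge0// divr_ge0// ltW.
- move=> n m /andP[sn _] _; rewrite -mulr_sumr mulrC.
  by apply: ler_pM => //; [exact: sumr_ge0|rewrite divr_ge0// ltW|exact: Vn].
move=> [//|n] m /andP[sn nN] mn; rewrite [n.+1.-1]/=.
have n0 : 0 < n.+1%:R :> R by rewrite ltr0n.
have mn1 : (m <= n)%N.
  by rewrite -ltnS; apply: leq_trans mn _; rewrite leq_subr.
(* m.+1 steps back from n.+1 one is still at or above s *)
have smn : (s <= n - m)%N by move: mn sn; clear; lia.
pose w : R := m.+1%:R `^ (- h); pose M : R := m.+1%:R.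
have M0 : 0 < M by rewrite ltr0n.
have w0 : 0 < w by rewrite powR_gt0.
have Ew : E * N%:R `^ (- h) <= E * w.
  rewrite ler_pM2l//; apply: powRN_le; [exact: ltW|by []|].
  by rewrite ler_nat (leq_trans _ nN).
have wM : w <= M^-1.
  rewrite /w -powR_inv1 ?(ltW M0)// /M; apply: ler_powR; last by rewrite lerN2.
  by rewrite ler1n.
rewrite powRND1// -/w -/M.
(* the recursion at n.+1 minus the recursion at n, shifted beyond m *)
have diff : n.+1%:R * (p n.+1 - p n) =
    V * (\sum_(1 <= r < m.+1) a r * (p (n.+1 - r)%N - p (n.+1 - r).-1)
       + (a m.+1 * p (n - m)%N
          - \sum_(m.+2 <= r < n.+2) (a r.-1 - a r) * p (n.+1 - r)%N)) - p n.
  have E1 : \sum_(1 <= r < n.+2) a r * p (n.+1 - r)%N =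
      \sum_(1 <= r < m.+1) a r * p (n.+1 - r)%N + (a m.+1 * p (n - m)%N +
      \sum_(m.+2 <= r < n.+2) a r * p (n.+1 - r)%N).
    rewrite (big_cat_nat _ (n := m.+1))//=; last by rewrite !ltnS leqW.
    by congr (_ + _); rewrite big_ltn ?subSS// !ltnS.
  have E2 : \sum_(1 <= r < n.+1) a r * p (n - r)%N =
      \sum_(1 <= r < m.+1) a r * p (n.+1 - r).-1 +
      \sum_(m.+2 <= r < n.+2) a r.-1 * p (n.+1 - r)%N.
    rewrite (big_cat_nat _ (n := m.+1))//=; congr (_ + _).
      by apply: eq_bigr => r _; rewrite -subn1 subnAC subn1.
    by rewrite [RHS]big_add1/=; apply: eq_bigr => r _; rewrite subSS.
  have -> : n.+1%:R * (p n.+1 - p n) = n.+1%:R * p n.+1 - n%:R * p n - p n.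
    by rewrite -natr1; ring.
  rewrite !rec E1 E2.
  under [in RHS]eq_bigr do rewrite mulrBr.
  under [X in _ + (_ - X)]eq_bigr do rewrite mulrBl.
  by rewrite !sumrB; ring.
have -> : p n.+1 - p n = V / n.+1%:R *
     \sum_(1 <= r < m.+1) a r * (p (n.+1 - r)%N - p (n.+1 - r).-1)
   + (V / n.+1%:R * (a m.+1 * p (n - m)%N
          - \sum_(m.+2 <= r < n.+2) (a r.-1 - a r) * p (n.+1 - r)%N)
      - p n / n.+1%:R).
  apply: (mulfI (lt0r_neq0 n0)); rewrite diff; field; exact: lt0r_neq0.
apply: (le_trans (ler_normD _ _)); apply: lerD.
  rewrite mulr_sumr; apply: (le_trans (ler_norm_sum _ _ _)).
  apply: ler_sum => r _; rewrite mulrA normrM [X in X * _]ger0_norm//.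
  by rewrite mulr_ge0// divr_ge0// ltW.
have mid0 : 0 <= a m.+1 * p (n - m)%N by rewrite mulr_ge0// ltW.
have mid : a m.+1 * p (n - m)%N <= c * E * (w / M).
  have -> : c * E * (w / M) = (c * M^-1) * (E * w) by ring.
  apply: ler_pM => //; [exact: ltW|by rewrite aE ler_pM2l|].
  apply: le_trans Ew; apply: pE; rewrite smn (leq_trans _ nN)//.
  by apply: leqW; exact: leq_subr.
have step r : (m.+2 <= r)%N -> 0 <= a r.-1 - a r <= D%:R * c * (w / M).
  case: r => // r; rewrite ltnS => mr; rewrite [r.+1.-1]/=.
  have r0 : 0 < r%:R :> R by rewrite ltr0n (leq_trans _ mr).
  have r10 : 0 < r.+1%:R :> R by rewrite ltr0n.
  rewrite !aE -mulrBr mulr_ge0 ?(ltW c0)//=; last first.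
    by rewrite subr_ge0; apply: powRN_le; rewrite ?ler_nat// ltW.
  have rw : r%:R `^ (- h) <= w.
    by apply: powRN_le; rewrite ?ltr0n ?ler_nat// ltW.
  have -> : D%:R * c * (w / M) = c * (D%:R * (w / M)) by ring.
  rewrite ler_pM2l//.
  have t01 : 0 <= (r.+1%:R^-1 : R) < 1.
    rewrite invr_ge0 (ltW r10)/= invf_lt1//.
    by rewrite ltr1n ltnS (leq_trans _ mr).
  have := powR_bernoulli hD t01.
  have rE : 1 - r.+1%:R^-1 = r%:R / r.+1%:R :> R.
    by rewrite -natr1; field; rewrite natr1 lt0r_neq0.
  rewrite rE powRM ?invr_ge0 ?(ltW r0) ?(ltW r10)//.
  have -> : r.+1%:R^-1 `^ h = r.+1%:R `^ (- h) :> R.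
    by rewrite -powR_inv1 ?(ltW r10)// -powRrM mulN1r.
  move=> H; have rh0 : 0 < r%:R `^ (- h) :> R by rewrite powR_gt0.
  have rrh : r%:R `^ (- h) * r%:R `^ h = 1 :> R.
    by rewrite powRN mulVf// gt_eqF// powR_gt0.
  have : r%:R `^ (- h) * (1 - D%:R / r.+1%:R) <= r.+1%:R `^ (- h) :> R.
    have := H; rewrite -(ler_pM2l rh0) [X in _ <= X -> _]mulrA rrh mul1r; exact.
  rewrite mulrBr mulr1 => H2.
  apply: (@le_trans _ _ (r%:R `^ (- h) * (D%:R / r.+1%:R))).
    by rewrite lerBlDr -lerBlDl.
  rewrite mulrCA ler_wpM2l//; apply: ler_pM.
  - exact: ltW.
  - by rewrite invr_ge0 ltW.
  - exact: rw.
  - by rewrite lef_pV2 ?posrE// ler_nat ltnW// ltnS.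
have far : \sum_(m.+2 <= r < n.+2) (a r.-1 - a r) * p (n.+1 - r)%N
    <= D%:R * c * (w / M).
  apply: (@le_trans _ _
    (\sum_(m.+2 <= r < n.+2) D%:R * c * (w / M) * p (n.+1 - r)%N)).
    apply: ler_sum_nat => r /andP[mr _]; rewrite ler_pM2r//.
    by have /andP[] := step r mr.
  rewrite -mulr_sumr ler_piMr//.
    by rewrite !mulr_ge0 ?invr_ge0// ltW.
  by apply: le_trans p1; apply: sum_tail_rev_le => // k; exact: ltW.
have far0 : 0 <= \sum_(m.+2 <= r < n.+2) (a r.-1 - a r) * p (n.+1 - r)%N.
  rewrite big_nat_cond; apply: sumr_ge0 => r /andP[/andP[mr _] _].
  by rewrite mulr_ge0 ?(ltW (p0 _))//; have /andP[] := step r mr.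
have pn : p n / n.+1%:R <= E * (w / M).
  rewrite mulrA; apply: ler_pM.
  - exact: ltW.
  - by rewrite invr_ge0 ltW.
  - apply: le_trans Ew; apply: pE; rewrite (ltnW nN) andbT.
    by rewrite -ltnS.
  - by rewrite lef_pV2 ?posrE// ler_nat ltnS.
set x := a m.+1 * _ in mid0 mid *; set y := \sum_(_ <= _ < _) _ in far far0 *.
have pn0 : 0 <= p n / n.+1%:R by rewrite divr_ge0// ltW.
have v0 : 0 <= V / n.+1%:R by rewrite divr_ge0// ltW.
have wM0 : 0 <= w / M by rewrite divr_ge0// ltW.
apply: (le_trans (ler_normB _ _)); rewrite (ger0_norm pn0) addrC.
rewrite /C mulrDl; apply: lerD => //.
rewrite normrM (ger0_norm v0) -[X in _ <= X]mulrA; apply: ler_pM => //.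
  exact: Vn.
apply: (le_trans (ler_normB _ _)).
by rewrite (ger0_norm mid0) (ger0_norm far0) mulrDl; apply: lerD.
Qed.

Lemma cycle_recursionZ (R : realType) (V u : R) (a p : nat -> R) :
  cycle_recursion V a p -> cycle_recursion V a (fun n => p n / u).
Proof.
move=> rec n; rewrite mulrA rec -mulrA mulr_suml; congr (_ * _).
by apply: eq_bigr => r _; rewrite mulrA.
Qed.

(** One long cycle suffices: all [a_r] with [r <= N] are at least [a_N], and
    [p_N <= Ac / rho < 1] leaves positive mass to the values below [N]. *)
Lemma supercritical_prob_lower (R : realType) (h c Ac rho : R)
    (a p : nat -> R) (N : nat) :
  0 < c -> 0 < rho -> (0 < N)%N -> (forall r, a r = c * r%:R `^ (- h)) ->
  0 <= h -> (forall m, \sum_(1 <= r < m.+1) a r <= Ac) ->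
  (forall k, 0 < p k) -> cycle_recursion (N%:R / rho) a p ->
  \sum_(0 <= j < N.+1) p j = 1 ->
  c / rho * (1 - Ac / rho) * N%:R `^ (- h) <= p N.
Proof.
move=> c0 rho0 N0 aE h0 aAc p0 rec p1.
have NR : 0 < N%:R :> R by rewrite ltr0n.
have a0 r : 0 <= a r by rewrite aE mulr_ge0 ?powR_ge0// ltW.
have pNE : p N = rho^-1 * \sum_(1 <= r < N.+1) a r * p (N - r)%N.
  apply: (mulfI (lt0r_neq0 NR)); rewrite rec; ring.
have sumE : \sum_(1 <= r < N.+1) p (N - r)%N = 1 - p N.
  rewrite -p1 [in RHS]big_nat_recr//= addrK big_nat_rev/= add1n.
  rewrite big_add1/=; apply: eq_big_nat => r rN; congr (p _).
  by move: rN; clear; lia.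
have ple k : (k <= N)%N -> p k <= 1.
  move=> kN; rewrite -p1 big_mkord (bigD1 (Ordinal (kN : k < N.+1)%N))//= lerDl.
  by apply: sumr_ge0 => i _; exact: ltW.
have up : p N <= Ac / rho.
  rewrite pNE mulrC ler_pM2r ?invr_gt0//; apply: le_trans (aAc N).
  by apply: ler_sum_nat => r _; rewrite ler_piMr// ple// leq_subr.
have low : c * N%:R `^ (- h) * (1 - p N) <= \sum_(1 <= r < N.+1) a r * p (N - r)%N.
  rewrite -sumE mulr_sumr; apply: ler_sum_nat => r /andP[r1 rN].
  rewrite ler_pM2r// aE ler_pM2l//; apply: powRN_le => //; first by rewrite ltr0n.
  by rewrite ler_nat.
have -> : c / rho * (1 - Ac / rho) * N%:R `^ (- h) =
    rho^-1 * (c * N%:R `^ (- h) * (1 - Ac / rho)) by ring.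
rewrite pNE ler_pM2l ?invr_gt0//; apply: le_trans low.
rewrite ler_pM2l; first by lra.
by rewrite mulr_gt0// powR_gt0.
Qed.

(** The three bounds above, for [p] normalized on [0, N], with [rho1] and [rho2]
    at one and two quarters of the way from [Ac] to [rho], and [eps] such that
    [N - r] stays above three quarters of the way. *)
Lemma supercritical_prob_ratio (R : realType) (h c Ac rho : R) (D : nat) :
  1 <= h <= D%:R -> 0 < c -> 0 <= Ac < rho ->
  exists C eps : R, exists N0 : nat, [/\ 0 < C, 0 < eps <= 1 &
    forall (N : nat) (a p : nat -> R), (N0 <= N)%N ->
      (forall r, a r = c * r%:R `^ (- h)) ->
      (forall m, \sum_(1 <= r < m.+1) a r <= Ac) ->
      (forall k, 0 < p k) -> cycle_recursion (N%:R / rho) a p ->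
      forall r, (r <= N)%N -> r%:R <= eps * N%:R ->
        `|p (N - r)%N / p N - 1| <= C * (r%:R / N%:R)].
Proof.
move=> hD c0 /andP[Ac0 Acr]; have /andP[h1 _] := hD.
have h0 : 0 < h by exact: lt_le_trans h1.
have rho0 : 0 < rho by exact: le_lt_trans Acr.
pose g := rho - Ac; have g0 : 0 < g by rewrite subr_gt0.
pose k1 := g / (8 * rho); have k10 : 0 < k1 by rewrite divr_gt0// mulr_gt0.
have rho1P : 0 <= Ac < Ac + g / 4 by lra.
have rho2P : 0 <= Ac < Ac + g / 2 by lra.
have [B1 B10 dens] := prob_density_bound h0 c0 rho1P.
have E0 : 0 < B1 * k1 `^ (- h) by rewrite mulr_gt0// powR_gt0.
have [B2 B20 incr] := prob_increment_bound hD c0 rho2P E0.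
pose c4 := c / rho * (1 - Ac / rho).
have c40 : 0 < c4.
  by rewrite mulr_gt0 ?divr_gt0// subr_gt0 ltr_pdivrMr// mul1r.
exists (B2 * k1 `^ (- (h + 1)) / c4), (g / (4 * rho)), (Num.truncn k1^-1).+1.
split; [by rewrite divr_gt0// mulr_gt0 ?powR_gt0| |].
  by rewrite divr_gt0 ?mulr_gt0//= ler_pdivrMr ?mulr_gt0// /g; lra.
move=> N a p N0N aE aAc p0 rec r rN reps.
have N0 : (0 < N)%N by exact: leq_trans N0N.
have NR : 0 < N%:R :> R by rewrite ltr0n.
have kN : 1 <= k1 * N%:R.
  rewrite mulrC -ler_pdivrMr// mul1r; apply/ltW/(lt_le_trans (truncnS_gt _)).
  by rewrite ler_nat.
pose V := N%:R / rho; have V0 : 0 < V by rewrite divr_gt0.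
have kV : k1 * N%:R = g * V / 8.
  by rewrite /k1 /V; field; rewrite lt0r_neq0.
have rhoV : rho * V = N%:R by rewrite /V mulrC divfK// lt0r_neq0.
pose S := \sum_(0 <= j < N.+1) p j.
have S0 : 0 < S.
  by rewrite /S big_nat_recr//= ltr_wpDl// sumr_ge0// => i _; exact: ltW.
pose q j := p j / S.
have q0 j : 0 < q j by rewrite divr_gt0.
have qrec : cycle_recursion V a q by exact: cycle_recursionZ.
have q1 : \sum_(0 <= j < N.+1) q j = 1.
  by rewrite /q -mulr_suml divff// lt0r_neq0.
have q1' : \sum_(0 <= j < N.+1) q j <= 1 by rewrite q1.
pose s1 := Num.truncn ((Ac + g / 4) * V).
pose s2 := Num.truncn ((Ac + g / 2) * V).
have /andP[s1l s1u] : s1%:R <= (Ac + g / 4) * V < s1.+1%:R.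
  by apply: truncn_itv; rewrite mulr_ge0// ?ltW//; lra.
have /andP[s2l s2u] : s2%:R <= (Ac + g / 2) * V < s2.+1%:R.
  by apply: truncn_itv; rewrite mulr_ge0// ?ltW//; lra.
have epsV : g / (4 * rho) * N%:R = g * V / 4.
  by rewrite /V; field; rewrite lt0r_neq0.
have rhoVE : rho * V = Ac * V + g * V by rewrite /g; ring.
have qlow : c4 * N%:R `^ (- h) <= q N.
  by apply: (supercritical_prob_lower c0 rho0 N0 aE _ aAc q0 qrec q1); exact: ltW.
move: reps; rewrite epsV => reps.
clearbody c4 s1 s2 V k1 g.
have AV : 0 <= Ac * V by rewrite mulr_ge0// ltW.
have far_sub (i j : nat) (x : R) : 0 < x -> i%:R + x <= j%:R ->
    (i < j)%N /\ x <= (j - i)%:R.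
  move=> x0 ij; have ltij : (i < j)%N by rewrite -(ltr_nat R); lra.
  by split=> //; rewrite natrB ?(ltnW ltij)//; lra.
have kN0 : 0 < k1 * N%:R by rewrite mulr_gt0.
have qE j : (s2 <= j <= N)%N -> q j <= B1 * k1 `^ (- h) * N%:R `^ (- h).
  move=> /andP[s2j jN]; have s2jR : s2%:R <= j%:R :> R by rewrite ler_nat.
  have [s1j dj] : (s1 < j)%N /\ k1 * N%:R <= (j - s1)%:R.
    apply: far_sub => //; move: s2u; rewrite -[s2.+1%:R]natr1; clear -s1l kV kN s2jR; lra.
  have qj : q j <= B1 * (j - s1)%:R `^ (- h).
    by apply: (dens V a q N s1) => //; [exact: ltW|rewrite s1j].
  apply: (le_trans qj); rewrite -mulrA -powRNM// ler_pM2l//.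
  by apply: powRN_le => //; exact: ltW.
have qincr n : (N - r < n <= N)%N ->
    `|q n - q n.-1| <= B2 * k1 `^ (- (h + 1)) * N%:R `^ (- (h + 1)).
  move=> /andP[rn nN].
  have nR : N%:R - r%:R <= n%:R :> R by rewrite -natrB// ler_nat ltnW.
  have [s2n dn] : (s2 < n)%N /\ k1 * N%:R <= (n - s2)%:R.
    by apply: far_sub => //; lra.
  have qn : `|q n - q n.-1| <= B2 * (n - s2)%:R `^ (- (h + 1)).
    by apply: (incr V a q N s2) => //; [exact: ltW|rewrite s2n].
  apply: (le_trans qn); rewrite -mulrA -powRNM// ler_pM2l//.
  by apply: powRN_le => //; lra.
have qdiff : `|q (N - r)%N - q N|
    <= r%:R * (B2 * k1 `^ (- (h + 1)) * N%:R `^ (- (h + 1))).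
  set b := B2 * _ * _ in qincr *; clear reps.
  elim: r rN qincr => [|r IH] rN qincr.
    by rewrite subn0 subrr normr0 mul0r.
  have -> : q (N - r.+1)%N - q N =
      (q (N - r)%N - q N) - (q (N - r)%N - q (N - r).-1).
    by rewrite subnS; ring.
  apply: (le_trans (ler_normB _ _)); rewrite -natr1 mulrDl mul1r; apply: lerD.
    apply: IH; first exact: ltnW.
    move=> n /andP[rn nN]; apply: qincr; rewrite nN andbT.
    by apply: leq_ltn_trans rn; rewrite leq_sub2l.
  apply: qincr; rewrite leq_subr andbT.
  by rewrite ltn_sub2l// leqnn.
have -> : p (N - r)%N / p N - 1 = (q (N - r)%N - q N) / q N.
  by rewrite /q; field; rewrite !lt0r_neq0.
rewrite normrM normfV (gtr0_norm (q0 N)) ler_pdivrMr//.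
apply: (le_trans qdiff).
set Nh := N%:R `^ (- h) in qlow *; set b := B2 * k1 `^ _.
have b0 : 0 < b by rewrite mulr_gt0// powR_gt0.
rewrite powRND1// -/Nh.
have -> : r%:R * (b * (Nh / N%:R)) = b / c4 * (r%:R / N%:R) * (c4 * Nh).
  by field; rewrite !lt0r_neq0.
by rewrite ler_wpM2l// mulr_ge0 ?divr_ge0// ltW.
Qed.

(** * Loop weights, the critical density and the limiting loop sum *)

(** A telescoping majorant; [h - 1 >= 1 / 2] allows the exponent to be replaced
    by that of the square root. *)
Lemma powR_telescope_le (R : realType) (h : R) (r : nat) :
  3 / 2 <= h -> (0 < r)%N ->
  r.+1%:R `^ (- h) <= 2 * (r%:R `^ (- (h - 1)) - r.+1%:R `^ (- (h - 1))) :> R.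
Proof.
move=> h32 r0; pose n : R := r.+1%:R; pose t := n^-1.
have rR : 1 <= r%:R :> R by rewrite ler1n.
have nE : n = r%:R + 1 by rewrite /n natr1.
have n0 : 0 < n by rewrite ltr0n.
have t0 : 0 < t by rewrite invr_gt0.
have nt : n * t = 1 by rewrite divff// lt0r_neq0.
have t1 : t <= 2^-1 by rewrite lef_pV2 ?posrE// nE; lra.
have rE : r%:R = n * (1 - t) by rewrite mulrBr nt nE; ring.
have u0 : 0 < 1 - t by lra.
have sqrt_le : (1 - t) `^ (h - 1) <= 1 - t / 2.
  apply: (@le_trans _ _ ((1 - t) `^ 2^-1)).
    by apply: ger_powR; rewrite ?u0/=; lra.
  rewrite powR12_sqrt ?(ltW u0)// -[leRHS]ger0_norm; last lra.
  by rewrite -sqrtr_sqr ler_sqrt ?sqr_ge0//; nra.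
have ge1 : 1 + t / 2 <= (1 - t) `^ (- (h - 1)).
  rewrite powRN; apply: (@le_trans _ _ (1 - t / 2)^-1); last first.
    by rewrite lef_pV2 ?posrE ?powR_gt0//; lra.
  have w0 : 0 < 1 - t / 2 by lra.
  by rewrite -[leRHS]mul1r ler_pdivlMr//; nra.
rewrite -/n rE powRNM//.
have -> : n `^ (- h) = n `^ (- (h - 1)) * t.
  by rewrite -[in LHS](subrK 1 h) powRND1.
have w0 : 0 < n `^ (- (h - 1)) by rewrite powR_gt0.
have -> : 2 * (n `^ (- (h - 1)) * (1 - t) `^ (- (h - 1)) - n `^ (- (h - 1)))
  = n `^ (- (h - 1)) * (2 * ((1 - t) `^ (- (h - 1)) - 1)) by ring.
by rewrite ler_pM2l//; lra.
Qed.

Lemma powR_tail_le (R : realType) (h : R) (m n : nat) :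
  3 / 2 <= h -> (0 < m <= n)%N ->
  \sum_(m.+1 <= r < n.+1) r%:R `^ (- h) <= 2 * m%:R `^ (- (h - 1)) :> R.
Proof.
move=> h32 /andP[m0 mn].
have tele : \sum_(m <= r < n) r.+1%:R `^ (- h) <=
    \sum_(m <= r < n) 2 * (r%:R `^ (- (h - 1)) - r.+1%:R `^ (- (h - 1))) :> R.
  apply: ler_sum_nat => r /andP[mr _].
  by apply: powR_telescope_le => //; exact: leq_trans mr.
rewrite big_add1/=; apply: (le_trans tele).
rewrite -mulr_sumr ler_pM2l//.
have -> : \sum_(m <= r < n) (r%:R `^ (- (h - 1)) - r.+1%:R `^ (- (h - 1)))
    = m%:R `^ (- (h - 1)) - n%:R `^ (- (h - 1)) :> R.
  under eq_bigr do rewrite -opprB.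
  by rewrite sumrN telescope_sumr// opprB.
by rewrite lerBlDr lerDl powR_ge0.
Qed.

(** The value on the diagonal of the heat kernel at time [r beta]. *)
Definition loop_weight (R : realType) (d : nat) (beta : R) (r : nat) : R :=
  (2 * pi * beta * r%:R) `^ (- (d%:R / 2)).

Lemma loop_weightE (R : realType) (d : nat) (beta : R) (r : nat) : 0 < beta ->
  loop_weight d beta r =
  (2 * pi * beta) `^ (- (d%:R / 2)) * r%:R `^ (- (d%:R / 2)).
Proof.
move=> b0; rewrite /loop_weight powRM//.
by rewrite ltW// !mulr_gt0 ?pi_gt0.
Qed.

Lemma loop_const_gt0 (R : realType) (d : nat) (beta : R) : 0 < beta ->
  0 < (2 * pi * beta) `^ (- (d%:R / 2)).
Proof. by move=> b0; rewrite powR_gt0// !mulr_gt0 ?pi_gt0. Qed.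

Lemma loop_weight_gt0 (R : realType) (d : nat) (beta : R) (r : nat) :
  0 < beta -> (0 < r)%N -> 0 < loop_weight d beta r.
Proof. by move=> b0 r0; rewrite powR_gt0// !mulr_gt0 ?pi_gt0 ?ltr0n. Qed.

Lemma loop_weight_ge0 (R : realType) (d : nat) (beta : R) (r : nat) :
  0 <= loop_weight d beta r.
Proof. exact: powR_ge0. Qed.

Lemma loop_weight_nonincreasing (R : realType) (d : nat) (beta : R) (r : nat) :
  0 < beta -> (0 < r)%N -> loop_weight d beta r.+1 <= loop_weight d beta r.
Proof.
move=> b0 r0; apply: powRN_le; first by rewrite divr_ge0.
  by rewrite !mulr_gt0 ?pi_gt0 ?ltr0n.
by rewrite ler_pM2l ?mulr_gt0 ?pi_gt0// ler_nat.
Qed.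

Lemma loop_weight_tail (R : realType) (d : nat) (beta : R) (m n : nat) :
  (3 <= d)%N -> 0 < beta -> (0 < m <= n)%N ->
  \sum_(m.+1 <= r < n.+1) loop_weight d beta r <=
  (2 * pi * beta) `^ (- (d%:R / 2)) * (2 * m%:R `^ (- (d%:R / 2 - 1))).
Proof.
move=> hd b0 mn.
under eq_bigr do rewrite loop_weightE//.
rewrite -mulr_sumr ler_pM2l ?loop_const_gt0//; apply: powR_tail_le => //.
by rewrite ler_pM2r ?invr_gt0// ler_nat.
Qed.

Lemma nondecreasing_partial_sum (R : realType) (f : nat -> R) :
  (forall r, 0 <= f r) ->
  nondecreasing_seq (fun n => \sum_(1 <= r < n.+1) f r).
Proof.
by move=> f0; apply/nondecreasing_seqP => n; rewrite [leRHS]big_nat_recr//= lerDl.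
Qed.

Lemma cvg_rho_c (R : realType) (d : nat) (beta : R) :
  (3 <= d)%N -> 0 < beta ->
  \sum_(1 <= r < n.+1) loop_weight d beta r @[n --> \oo] --> rho_c d beta.
Proof.
move=> hd b0.
have nd := nondecreasing_partial_sum (loop_weight_ge0 d beta).
apply: (nondecreasing_is_cvgn nd).
exists (loop_weight d beta 1 +
  (2 * pi * beta) `^ (- (d%:R / 2)) * (2 * 1%:R `^ (- (d%:R / 2 - 1)))).
move=> _ [n _ <-]; 
  apply: (@le_trans _ _ (\sum_(1 <= r < n.+2) loop_weight d beta r)).
  exact: nd.
rewrite big_ltn//.
by rewrite lerD2l; exact: (@loop_weight_tail _ d beta 1 n.+1).
Qed.

Lemma partial_sum_le_rho_c (R : realType) (d : nat) (beta : R) (n : nat) :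
  (3 <= d)%N -> 0 < beta ->
  \sum_(1 <= r < n.+1) loop_weight d beta r <= rho_c d beta.
Proof.
move=> hd b0; have cv := cvg_rho_c hd b0.
rewrite -(cvg_lim (@Rhausdorff R) cv).
apply: (nondecreasing_cvgn_le (nondecreasing_partial_sum (loop_weight_ge0 d beta))).
by apply/cvg_ex; exists (rho_c d beta).
Qed.

Lemma rho_c_gt0 (R : realType) (d : nat) (beta : R) :
  (3 <= d)%N -> 0 < beta -> 0 < rho_c d beta.
Proof.
move=> hd b0; apply: lt_le_trans (partial_sum_le_rho_c 1 hd b0).
by rewrite big_nat1 loop_weight_gt0.
Qed.

(** The Gaussian factor of the heat kernel at time [r beta] and distance [s]. *)
Definition heat_factor (R : realType) (beta s : R) (r : nat) : R :=
  expR (- (s ^+ 2 / (2 * (r%:R * beta)))).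

Lemma heat_factor_gt0 (R : realType) (beta s : R) (r : nat) :
  0 < heat_factor beta s r.
Proof. exact: expR_gt0. Qed.

Lemma heat_factor_le1 (R : realType) (beta s : R) (r : nat) :
  0 < beta -> heat_factor beta s r <= 1.
Proof.
move=> b0; rewrite -expR0 ler_expR oppr_le0 divr_ge0 ?sqr_ge0//.
by rewrite !mulr_ge0// ltW.
Qed.

Lemma heat_kernelE (R : realType) (d : nat) (beta : R) (r : nat)
    (x y : 'rV[R]_d) :
  heat_kernel (r%:R * beta) x y =
  loop_weight d beta r * heat_factor beta (euclidean_norm (x - y)) r.
Proof. by rewrite /heat_kernel /loop_weight -(mulrA _ beta) (mulrC beta). Qed.

(** The function [psi] of the supercritical regime. *)
Definition loop_sum (R : realType) (d : nat) (beta s : R) : R :=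
  limn (fun n : nat =>
    \sum_(1 <= r < n.+1) loop_weight d beta r * heat_factor beta s r).

Lemma loop_sum_term_ge0 (R : realType) (d : nat) (beta s : R) (r : nat) :
  0 <= loop_weight d beta r * heat_factor beta s r.
Proof. by rewrite mulr_ge0 ?loop_weight_ge0// ltW ?heat_factor_gt0. Qed.

Lemma loop_sum_term_le (R : realType) (d : nat) (beta s : R) (r : nat) :
  0 < beta ->
  loop_weight d beta r * heat_factor beta s r <= loop_weight d beta r.
Proof.
by move=> b0; rewrite ler_piMr ?loop_weight_ge0 ?heat_factor_le1.
Qed.

(** The remainder of the series of [loop_sum] is dominated by that of [rho_c],
    hence is small uniformly in [s]. *)
Lemma loop_sum_partial (R : realType) (d : nat) (beta s : R) (n : nat) :
  (3 <= d)%N -> 0 < beta ->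
  0 <= loop_sum d beta s
       - \sum_(1 <= r < n.+1) loop_weight d beta r * heat_factor beta s r
    <= rho_c d beta - \sum_(1 <= r < n.+1) loop_weight d beta r.
Proof.
move=> hd b0.
have nd := nondecreasing_partial_sum (loop_sum_term_ge0 d beta s).
have cv : cvgn (fun n : nat =>
    \sum_(1 <= r < n.+1) loop_weight d beta r * heat_factor beta s r).
  apply: (nondecreasing_is_cvgn nd); exists (rho_c d beta) => _ [m _ <-].
  apply: le_trans (partial_sum_le_rho_c m hd b0).
  by apply: ler_sum_nat => r _; exact: loop_sum_term_le.
rewrite subr_ge0 (nondecreasing_cvgn_le nd cv)/= lerBlDr.
apply: limr_le => //; near=> m.
have nm : (n <= m)%N by near: m; exists n.
rewrite (big_cat_nat _ (n := n.+1))//= addrC lerD2r.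
apply: (@le_trans _ _ (\sum_(n.+1 <= r < m.+1) loop_weight d beta r)).
  by apply: ler_sum_nat => r _; exact: loop_sum_term_le.
rewrite lerBrDl -big_cat_nat//=; exact: partial_sum_le_rho_c.
Unshelve. all: by end_near. Qed.

Lemma loop_sum_gt0 (R : realType) (d : nat) (beta s : R) :
  (3 <= d)%N -> 0 < beta -> 0 < loop_sum d beta s.
Proof.
move=> hd b0; have /andP[+ _] := loop_sum_partial s 1 hd b0.
rewrite subr_ge0 big_nat1; apply: lt_le_trans.
by rewrite mulr_gt0 ?loop_weight_gt0 ?heat_factor_gt0.
Qed.

(** From [u <= exp u] with [u = x / (2 beta d)], raised to the power [d]. *)
Lemma powR_expR_le (R : realType) (h beta x : R) (d : nat) :
  0 < beta -> h <= d%:R -> (0 < d)%N -> 1 <= x ->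
  x `^ h * expR (- (x / (2 * beta))) <= (2 * beta * d%:R) ^+ d.
Proof.
move=> b0 hd d0 x1; have x0 : 0 < x by exact: lt_le_trans x1.
have dR : 0 < d%:R :> R by rewrite ltr0n.
rewrite expRN ler_pdivrMr ?expR_gt0//.
apply: (@le_trans _ _ (x ^+ d)).
  by rewrite -powR_mulrn ?(ltW x0)//; apply: ler_powR.
pose u := x / (2 * beta * d%:R).
have u0 : 0 < u by rewrite divr_gt0// !mulr_gt0.
have -> : x = 2 * beta * d%:R * u.
  by rewrite mulrC divfK// lt0r_neq0// !mulr_gt0.
rewrite exprMn ler_pM2l ?exprn_gt0 ?mulr_gt0//.
have -> : 2 * beta * d%:R * u / (2 * beta) = d%:R * u.
  by field; rewrite lt0r_neq0.
rewrite expRM_natl; apply: lerXn2r; rewrite ?nnegrE ?expR_ge0 ?(ltW u0)//.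
by apply: le_trans (expR_ge1Dx _); rewrite lerDr.
Qed.

(** Loops of length [r <= s^2] contribute at most a constant times [s^(-d)] each,
    by [powR_expR_le] with [x = s^2 / r]; the longer ones contribute at most the
    tail of the series of [rho_c] beyond [s^2]. *)
Lemma loop_sum_decay (R : realType) (d : nat) (beta : R) :
  (3 <= d)%N -> 0 < beta ->
  exists C : R, forall s, 1 <= s -> loop_sum d beta s <= C * s `^ (2 - d%:R).
Proof.
move=> hd b0; pose h : R := d%:R / 2.
have h32 : 3 / 2 <= h by rewrite ler_pM2r ?invr_gt0// ler_nat.
have hdd : h <= d%:R by rewrite /h ler_pdivrMr// ler_peMr// ler1n.
have d0 : (0 < d)%N by exact: leq_trans hd.
pose c := (2 * pi * beta) `^ (- h).
have c0 : 0 < c by exact: loop_const_gt0.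
pose K := (2 * beta * d%:R) ^+ d.
exists (c * K + c * (2 * 2 `^ (h - 1))) => s s1.
have s0 : 0 < s by exact: lt_le_trans s1.
pose v := s ^+ 2; have v1 : 1 <= v by rewrite exprn_ege1.
have v0 : 0 < v by exact: lt_le_trans v1.
have vE : v `^ (- (h - 1)) = s `^ (2 - d%:R).
  rewrite /v -powR_mulrn ?(ltW s0)// -powRrM; congr (_ `^ _).
  by rewrite /h; field.
pose m := Num.truncn v.
have /andP[mv vm] := truncn_itv (ltW v0); rewrite -/m in mv vm.
have m0 : (0 < m)%N by rewrite /m truncn_gt0.
have m0R : 0 < m%:R :> R by rewrite ltr0n.
have vm2 : v / 2 <= m%:R.
  have : 1 <= m%:R :> R by rewrite ler1n.
  by move: vm; rewrite -[m.+1%:R]natr1; lra.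
have /andP[_] := loop_sum_partial s m hd b0.
rewrite lerBlDr => /le_trans; apply; rewrite addrC mulrDl; apply: lerD.
  have term r : (1 <= r < m.+1)%N ->
      loop_weight d beta r * heat_factor beta s r <= c * (v `^ (- h) * K).
    move=> /andP[r1 rm]; rewrite loop_weightE// -/h -/c -mulrA ler_pM2l//.
    have r0 : 0 < r%:R :> R by rewrite ltr0n.
    have x1 : 1 <= v / r%:R.
      by rewrite ler_pdivlMr// mul1r (le_trans _ mv)// ler_nat.
    have -> : r%:R `^ (- h) = v `^ (- h) * (v / r%:R) `^ h :> R.
      rewrite (@powRM _ v r%:R^-1) ?invr_ge0 ?(ltW v0) ?(ltW r0)// mulrA (powRN v).
      rewrite mulVf ?mul1r; last by rewrite gt_eqF// powR_gt0.
      by rewrite -powR_inv1 ?(ltW r0)// -powRrM mulN1r.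
    rewrite -mulrA ler_pM2l ?powR_gt0//.
    have -> : heat_factor beta s r = expR (- (v / r%:R / (2 * beta))).
      by rewrite /heat_factor -/v; congr (expR (- _)); field; rewrite !lt0r_neq0.
    exact: powR_expR_le.
  apply: (le_trans (ler_sum_nat term)).
  rewrite sumr_const_nat subSS subn0 -mulrnAr -mulrA ler_pM2l//.
  rewrite -vE -[_ *+ m]mulr_natr.
  have -> : v `^ (- h) = v `^ (- (h - 1)) / v.
    by rewrite -[in LHS](subrK 1 h) powRND1.
  have K0 : 0 < K by rewrite exprn_gt0// !mulr_gt0 ?ltr0n.
  have -> : v `^ (- (h - 1)) / v * K * m%:R = K * v `^ (- (h - 1)) * (m%:R / v).
    by ring.
  rewrite ler_piMr ?mulr_ge0 ?powR_ge0 ?(ltW K0)//.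
  by rewrite ler_pdivrMr// mul1r.
rewrite -vE lerBlDr; have cv := cvg_rho_c hd b0.
apply: (cvgr_to_le cv); near=> n.
have mn : (m <= n)%N by near: n; exists m.
rewrite (big_cat_nat _ (n := m.+1))//= addrC lerD2r.
apply: (le_trans (loop_weight_tail hd b0 (introT andP (conj m0 mn)))).
rewrite -/h -/c -mulrA ler_pM2l// -mulrA ler_pM2l//.
have -> : 2 `^ (h - 1) = 2^-1 `^ (- (h - 1)) :> R.
  by rewrite -[2^-1]powR_inv1// -powRrM mulrNN mul1r.
rewrite -powRNM ?invr_gt0//; apply: powRN_le; [lra|by rewrite mulr_gt0// invr_gt0|].
by rewrite mulrC.
Unshelve. all: by end_near. Qed.

(** * Asymptotics of the kernel *)

Lemma side_gt0 (R : realType) (d : nat) (rho : R) (N : nat) :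
  0 < rho -> (0 < N)%N -> 0 < side d rho N.
Proof. by move=> r0 N0; rewrite powR_gt0// divr_gt0// ltr0n. Qed.

Lemma side_exp (R : realType) (d : nat) (rho : R) (N : nat) :
  0 < rho -> (0 < d)%N -> side d rho N ^+ d = N%:R / rho.
Proof.
move=> r0 d0; rewrite -powR_mulrn ?powR_ge0// -powRrM mulVf ?powRr1//.
  by rewrite divr_ge0// ltW.
by rewrite pnatr_eq0 -lt0n.
Qed.

(** The diffusive time scale [L^2] is negligible with respect to the volume, as
    [d >= 3]. *)
Lemma side_sqr_small (R : realType) (d : nat) (rho eta : R) :
  (3 <= d)%N -> 0 < rho -> 0 < eta ->
  exists N0 : nat, forall N, (N0 <= N)%N -> side d rho N ^+ 2 <= eta * N%:R.
Proof.
move=> hd r0 e0; pose T := 1 + (rho * eta)^-1.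
have d0 : (0 < d)%N by exact: leq_trans hd.
have i0 : 0 < (rho * eta)^-1 by rewrite invr_gt0 mulr_gt0.
have T1 : 1 <= T by rewrite lerDl ltW.
exists (Num.truncn (rho * T ^+ d)).+1 => N N0N.
have NR : rho * T ^+ d <= N%:R.
  by apply/ltW/(lt_le_trans (truncnS_gt _)); rewrite ler_nat.
have N0 : (0 < N)%N by exact: leq_trans N0N.
set L := side d rho N; have L0 : 0 < L by exact: side_gt0.
have LE : L ^+ d = N%:R / rho by exact: side_exp.
have NE : N%:R = rho * L ^+ d by rewrite LE mulrC divfK// lt0r_neq0.
have TL : T <= L.
  rewrite -(ler_pXn2r d0) ?nnegrE ?(ltW L0)//; last by rewrite (le_trans _ T1).
  by rewrite LE ler_pdivlMr// mulrC.
have L1 : 1 <= L by exact: le_trans TL.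
rewrite NE; apply: (@le_trans _ _ (eta * (rho * L ^+ 3))); last first.
  by rewrite ler_pM2l// ler_pM2l// ler_weXn2l.
rewrite exprS mulrA mulrA ler_peMl ?sqr_ge0//.
have : (rho * eta)^-1 <= L by apply: le_trans TL; rewrite lerDr.
by rewrite -[X in X <= _]mul1r ler_pdivrMr ?mulr_gt0// mulrC (mulrC rho).
Qed.

Lemma box_dist_sqr_le (R : realType) (d : nat) (L : R) (x y : 'rV[R]_d) :
  centred_box L x -> centred_box L y ->
  euclidean_norm (x - y) ^+ 2 <= d%:R * L ^+ 2.
Proof.
move=> [u bu <-] [v bv <-]; rewrite /euclidean_norm sqr_sqrtr; last first.
  by apply: sumr_ge0 => i _; exact: sqr_ge0.
apply: (@le_trans _ _ (\sum_(i < d) L ^+ 2)); last first.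
  by rewrite sumr_const card_ord mulr_natl.
apply: ler_sum => i _; rewrite !mxE -mulrBr exprMn ler_piMr ?sqr_ge0//.
have /andP[u1 u2] := bu i; have /andP[v1 v2] := bv i.
by rewrite -ler_sqrt// sqrtr_sqr sqrtr1 ler_norml; apply/andP; split; lra.
Qed.

Lemma free_gas_recursion (R : realType) (dO : measure_display)
    (Omega : measurableType dO) (d : nat) (beta L : R)
    (P : probability Omega R) (X : nat -> {mfun Omega >-> nat}) :
  (3 <= d)%N -> 0 < beta -> 0 < L -> free_cycle_law d beta L P X ->
  (forall n, 0 < prob_total P X n) /\
  cycle_recursion (L ^+ d) (loop_weight d beta) (prob_total P X).
Proof.
move=> hd b0 L0 [indep law].
pose lam (k : nat) : R := k%:R^-1 * (L ^+ d * loop_weight d beta k).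
have Ld0 : 0 < L ^+ d by rewrite exprn_gt0.
have lam0 k : (0 < k)%N -> 0 < lam k.
  by move=> k0; rewrite !mulr_gt0 ?invr_gt0 ?ltr0n// loop_weight_gt0.
have lam_sum m : \sum_(1 <= k < m.+1) lam k <= L ^+ d * rho_c d beta.
  apply: (@le_trans _ _ (L ^+ d * \sum_(1 <= k < m.+1) loop_weight d beta k)).
    rewrite mulr_sumr; apply: ler_sum_nat => k /andP[k1 _].
    rewrite /lam ler_piMl ?mulr_ge0 ?loop_weight_ge0 ?(ltW Ld0)//.
    by rewrite invf_le1 ?ltr0n// ler1n.
  by rewrite ler_pM2l//; exact: partial_sum_le_rho_c.
split; first exact: (prob_total_gt0 lam0 lam_sum indep law).
move=> n; rewrite (prob_total_rec lam0 indep law) mulr_sumr.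
apply: eq_big_nat => k /andP[k1 _]; rewrite /lam [k%:R * _]mulVKf ?mulrA//.
by rewrite pnatr_eq0 -lt0n.
Qed.

Lemma gamma_freeE (R : realType) (dO : measure_display)
    (Omega : measurableType dO) (P : probability Omega R)
    (X : nat -> {mfun Omega >-> nat}) (d : nat) (beta : R) (N : nat)
    (x y : 'rV[R]_d) :
  gamma_free P X beta N x y = \sum_(1 <= r < N.+1)
    loop_weight d beta r * heat_factor beta (euclidean_norm (x - y)) r
    * (prob_total P X (N - r)%N / prob_total P X N).
Proof. by apply: eq_bigr => r _; rewrite heat_kernelE. Qed.

(** The recursion at [n = N] in volume [N / rho]: the kernel is equal to [rho] on
    the diagonal. *)
Lemma diagonal_density (R : realType) (rho : R) (a p : nat -> R) (N : nat) :
  0 < rho -> (0 < N)%N -> (forall k, 0 < p k) ->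
  cycle_recursion (N%:R / rho) a p ->
  \sum_(1 <= r < N.+1) a r * (p (N - r)%N / p N) = rho.
Proof.
move=> r0 N0 p0 rec; have NR : 0 < N%:R :> R by rewrite ltr0n.
under eq_bigr do rewrite mulrA.
rewrite -mulr_suml; set s := \sum_(_ <= _ < _) _.
have -> : s = rho * p N.
  have := rec N; rewrite -/s => H.
  by apply: (mulfI (lt0r_neq0 NR)); rewrite mulrCA H; field; exact: lt0r_neq0.
by rewrite mulfK// lt0r_neq0.
Qed.

(** The exponents differ by a square divided by [2 r beta]. *)
Lemma heat_factor_exp_le (R : realType) (beta mu s : R) (r : nat) :
  0 < beta -> (0 < r)%N ->
  heat_factor beta s r * expR (- (mu ^+ 2 * beta / 2)) ^+ r
    <= expR (- (mu * s)).
Proof.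
move=> b0 r1; have r0 : 0 < r%:R :> R by rewrite ltr0n.
rewrite -expRM_natl -expRD ler_expR mulrN -opprD lerN2 -subr_ge0.
have -> : s ^+ 2 / (2 * (r%:R * beta)) + r%:R * (mu ^+ 2 * beta / 2) - mu * s
   = (s - mu * beta * r%:R) ^+ 2 / (2 * (r%:R * beta)).
  by field; rewrite !lt0r_neq0.
by rewrite divr_ge0 ?sqr_ge0// !mulr_ge0// ltW.
Qed.

Lemma subcritical_kernel_decay (R : realType) (d : nat) (beta rho : R) :
  (3 <= d)%N -> 0 < beta -> 0 < rho < rho_c d beta ->
  exists c : R, exists N0 : nat, [/\ 0 < c & forall (N : nat) (p : nat -> R),
    (N0 <= N)%N -> (forall k, 0 < p k) ->
    cycle_recursion (N%:R / rho) (loop_weight d beta) p ->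
    forall s, \sum_(1 <= r < N.+1) loop_weight d beta r * heat_factor beta s r
      * (p (N - r)%N / p N) <= rho_c d beta * expR (- (c * s))].
Proof.
move=> hd b0 /andP[rho0 rhoc].
have [M rhoM] : exists M, rho < \sum_(1 <= r < M.+1) loop_weight d beta r.
  have := cvgr_gt _ (cvg_rho_c hd b0) _ rhoc; move=> [M _ HM].
  by exists M; apply: HM => /=.
have [z1 [V0 [/andP[z0 z1lt] V00 Hz]]] := subcritical_prob_ratio rho0
  (fun k => @loop_weight_gt0 R d beta k b0)
  (fun k => @loop_weight_nonincreasing R d beta k b0) rhoM.
pose c := Num.sqrt (- ln z1 * 2 / beta).
have lz : 0 < - ln z1 by rewrite oppr_gt0 ln_lt0// z0.
have c0 : 0 < c by rewrite sqrtr_gt0 divr_gt0// mulr_gt0.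
have cE : expR (- (c ^+ 2 * beta / 2)) = z1.
  rewrite sqr_sqrtr ?ltW ?divr_gt0 ?mulr_gt0//.
  have -> : - (- ln z1 * 2 / beta * beta / 2) = ln z1.
    by field; exact: lt0r_neq0.
  by rewrite lnK.
exists c, (Num.truncn (V0 * rho)).+1; split => // N p N0N p0 rec s.
have NV : V0 <= N%:R / rho.
  rewrite ler_pdivlMr//; apply/ltW/(lt_le_trans (truncnS_gt _)).
  by rewrite ler_nat.
have pz r : (r <= N)%N -> p (N - r)%N / p N <= z1 ^+ r.
  move=> rN; rewrite ler_pdivrMr//; apply: (Hz _ _ NV p0 rec) => //.
  by rewrite mulrC divfK// lt0r_neq0.
apply: (@le_trans _ _ (\sum_(1 <= r < N.+1)
    loop_weight d beta r * expR (- (c * s)))).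
  apply: ler_sum_nat => r /andP[r1 rN]; rewrite -mulrA.
  apply: ler_wpM2l; first exact: loop_weight_ge0.
  apply: le_trans (heat_factor_exp_le c s b0 r1); rewrite cE.
  by rewrite ler_pM2l ?heat_factor_gt0// pz.
rewrite -mulr_suml ler_pM2r ?expR_gt0//; exact: partial_sum_le_rho_c.
Qed.

Lemma kernel_le_density (R : realType) (d : nat) (beta rho s : R)
    (p : nat -> R) (N : nat) :
  0 < beta -> 0 < rho -> (0 < N)%N -> (forall k, 0 < p k) ->
  cycle_recursion (N%:R / rho) (loop_weight d beta) p ->
  \sum_(1 <= r < N.+1) loop_weight d beta r * heat_factor beta s r
    * (p (N - r)%N / p N) <= rho.
Proof.
move=> b0 rho0 N0 p0 rec; rewrite -[leRHS](diagonal_density rho0 N0 p0 rec).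
apply: ler_sum_nat => r _; rewrite ler_pM2r ?divr_gt0//.
exact: loop_sum_term_le.
Qed.

Lemma kernel_ge0 (R : realType) (d : nat) (beta s : R)
    (p : nat -> R) (N : nat) : (forall k, 0 < p k) ->
  0 <= \sum_(1 <= r < N.+1) loop_weight d beta r * heat_factor beta s r
    * (p (N - r)%N / p N).
Proof.
move=> p0; apply: sumr_ge0 => r _.
by rewrite mulr_ge0 ?loop_sum_term_ge0// divr_ge0 ?ltW.
Qed.

(** The error splits into three parts, with [K] the integer part of [eps N]:
    loops of length at most [K], where [q_r] is close to [1]; the remainder
    [Rem] of convergent series; and loops longer than [K], where the heat factor
    is close to [1]. *)
Lemma supercritical_kernel_limit (R : realType) (d : nat) (beta rho eta : R) :
  (3 <= d)%N -> 0 < beta -> rho_c d beta < rho -> 0 < eta ->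
  exists N0 : nat, forall (N : nat) (p : nat -> R), (N0 <= N)%N ->
    (forall k, 0 < p k) ->
    cycle_recursion (N%:R / rho) (loop_weight d beta) p ->
    forall s, s ^+ 2 <= d%:R * side d rho N ^+ 2 ->
    `|\sum_(1 <= r < N.+1) loop_weight d beta r * heat_factor beta s r
        * (p (N - r)%N / p N) - (rho - rho_c d beta + loop_sum d beta s)| < eta.
Proof.
move=> hd b0 rhoc eta0; set A := rho_c d beta in rhoc *.
have A0 : 0 < A by exact: rho_c_gt0.
have rho0 : 0 < rho by exact: lt_trans rhoc.
have d0 : 0 < d%:R :> R by rewrite ltr0n (leq_trans _ hd).
pose h : R := d%:R / 2.
have h_itv : 1 <= h <= d%:R.
  rewrite /h ler_pdivlMr// mul1r ler_nat (ltnW hd)/=.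
  by rewrite ler_pdivrMr// ler_peMr ?ler1n// ltW.
have c0 := loop_const_gt0 d b0; rewrite -/h in c0.
have A_rho : 0 <= A < rho by rewrite ltW.
have [C [eps [N1 [C0 /andP[e0 e1] Hr]]]] := supercritical_prob_ratio h_itv c0 A_rho.
set a := loop_weight d beta.
pose AS m := \sum_(1 <= r < m.+1) a r.
have [M HM] : exists M, forall m, (M <= m)%N -> A - eta / (4 * (C + 1)) < AS m.
  have lt_A : A - eta / (4 * (C + 1)) < A.
    by rewrite ltrBlDr ltrDl divr_gt0// mulr_gt0// addr_gt0.
  by have [M _ HM] := cvgr_gt _ (cvg_rho_c hd b0) _ lt_A; exists M.
have sm0 : 0 < eta * (2 * beta * eps) / (4 * rho * d%:R).
  by rewrite divr_gt0 ?mulr_gt0.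
have [N2 HN2] := side_sqr_small hd rho0 sm0.
pose N3 := (Num.truncn (M.+1%:R / eps)).+1.
pose N4 := (Num.truncn (4 * C * M%:R * A / eta)).+1.
exists (maxn (maxn N1 N2) (maxn N3 N4)) => N p.
rewrite !geq_max => /andP[/andP[NN1 NN2] /andP[NN3 NN4]] p0 rec s s2.
have N0 : (0 < N)%N by exact: leq_trans NN3.
have NR : 0 < N%:R :> R by rewrite ltr0n.
pose q r := p (N - r)%N / p N.
have q0 r : 0 < q r by rewrite divr_gt0.
pose e r := heat_factor beta s r.
have e01 r : 0 < e r <= 1 by rewrite heat_factor_gt0 heat_factor_le1.
have a0 r : 0 <= a r by exact: loop_weight_ge0.
have qdev r : (r <= N)%N -> r%:R <= eps * N%:R -> `|q r - 1| <= C * (r%:R / N%:R).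
  apply: (Hr N a p NN1 _ _ p0 rec).
  - by move=> r'; exact: loop_weightE.
  - by move=> m; exact: partial_sum_le_rho_c.
pose K := Num.truncn (eps * N%:R).
have /andP[Kl Ku] : K%:R <= eps * N%:R < K.+1%:R.
  by apply: truncn_itv; rewrite mulr_ge0 ?ltW.
have KN : (K <= N)%N.
  by rewrite -(ler_nat R) (le_trans Kl)// ler_piMl.
have MK : (M <= K)%N.
  rewrite -ltnS -(ltr_nat R); apply: le_lt_trans Ku.
  rewrite mulrC -ler_pdivrMr//; apply: (@le_trans _ _ (M.+1%:R / eps)).
    by rewrite ler_pM2r ?invr_gt0// ler_nat.
  by apply/ltW/(lt_le_trans (truncnS_gt _)); rewrite ler_nat.
have diag := diagonal_density rho0 N0 p0 rec.
rewrite -/a -/A in diag *.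
pose Rem := (A - AS K) - (loop_sum d beta s - \sum_(1 <= r < K.+1) a r * e r).
have /andP[rem0 rem1] := loop_sum_partial s K hd b0.
rewrite -/a -/A -/(AS K) in rem0 rem1.
have head : \sum_(1 <= r < K.+1) a r * (1 - q r) * (1 - e r) =
    AS K - \sum_(1 <= r < K.+1) a r * e r
    - (\sum_(1 <= r < K.+1) a r * q r - \sum_(1 <= r < K.+1) a r * e r * q r).
  by rewrite -!sumrB; apply: eq_bigr => r _; ring.
have tail : \sum_(K.+1 <= r < N.+1) a r * q r * (1 - e r) =
    \sum_(K.+1 <= r < N.+1) a r * q r - \sum_(K.+1 <= r < N.+1) a r * e r * q r.
  by rewrite -sumrB; apply: eq_bigr => r _; ring.
have diagK : \sum_(1 <= r < K.+1) a r * q r + \sum_(K.+1 <= r < N.+1) a r * q r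
    = rho.
  by rewrite -[RHS]diag -big_cat_nat.
have -> : \sum_(1 <= r < N.+1) a r * heat_factor beta s r * (p (N - r)%N / p N)
    - (rho - A + loop_sum d beta s)
  = \sum_(1 <= r < K.+1) a r * (1 - q r) * (1 - e r)
    + Rem - \sum_(K.+1 <= r < N.+1) a r * q r * (1 - e r).
  have -> : \sum_(1 <= r < N.+1) a r * heat_factor beta s r * (p (N - r)%N / p N)
    = \sum_(1 <= r < K.+1) a r * e r * q r
      + \sum_(K.+1 <= r < N.+1) a r * e r * q r by rewrite -big_cat_nat.
  by rewrite head tail -diagK /Rem; ring.
have C10 : 0 < C + 1 by rewrite addr_gt0.
have eC : C * (eta / (4 * (C + 1))) <= eta / 4.
  have -> : eta / 4 = (C + 1) * (eta / (4 * (C + 1))).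
    by field; rewrite lt0r_neq0.
  by rewrite ler_pM2r ?lerDl// divr_gt0// mulr_gt0.
have eC' : eta / (4 * (C + 1)) <= eta / 4.
  by rewrite ler_pM2l// lef_pV2 ?posrE ?mulr_gt0// ler_peMr// lerDr ltW.
have HK := HM K MK; have HMM := HM M (leqnn M).
have B1 : `|\sum_(1 <= r < K.+1) a r * (1 - q r) * (1 - e r)| < eta / 2.
  have bnd : \sum_(1 <= r < K.+1) a r * (r%:R / N%:R)
      <= M%:R / N%:R * A + (AS K - AS M).
    rewrite (big_cat_nat _ (n := M.+1))//=; apply: lerD.
      apply: (@le_trans _ _ (\sum_(1 <= r < M.+1) a r * (M%:R / N%:R))).
        apply: ler_sum_nat => r /andP[_ rM]; apply: ler_wpM2l => //.
        by rewrite ler_pM2r ?invr_gt0// ler_nat.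
      rewrite -mulr_suml mulrC; apply: ler_wpM2l; first by rewrite divr_ge0.
      exact: partial_sum_le_rho_c.
    have -> : AS K - AS M = \sum_(M.+1 <= r < K.+1) a r.
      apply/eqP; rewrite subr_eq addrC; apply/eqP.
      by rewrite /AS -big_cat_nat.
    apply: ler_sum_nat => r /andP[_ rK]; rewrite ler_piMr//.
    by rewrite ler_pdivrMr// mul1r ler_nat (leq_trans _ KN).
  apply: (@le_lt_trans _ _ (C * \sum_(1 <= r < K.+1) a r * (r%:R / N%:R))).
    apply: (le_trans (ler_norm_sum _ _ _)); rewrite mulr_sumr.
    apply: ler_sum_nat => r /andP[r1 rK]; have /andP[er0 er1] := e01 r.
    have rK' : r%:R <= K%:R :> R by rewrite ler_nat.
    have := qdev r (leq_trans (rK : r <= K)%N KN) (le_trans rK' Kl).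
    rewrite distrC => qr.
    rewrite !normrM (ger0_norm (a0 r)) [X in _ * X]ger0_norm ?subr_ge0//.
    rewrite mulrCA -mulrA; apply: ler_wpM2l => //.
    apply: le_trans qr; rewrite ler_piMr// lerBlDr lerDl ltW//.
  have CN : C * (M%:R / N%:R * A) < eta / 4.
    have -> : C * (M%:R / N%:R * A) = C * M%:R * A / N%:R by ring.
    rewrite ltr_pdivrMr//.
    have : 4 * C * M%:R * A / eta < N%:R.
      by apply: (lt_le_trans (truncnS_gt _)); rewrite ler_nat.
    by rewrite ltr_pdivrMr//; lra.
  have : C * \sum_(1 <= r < K.+1) a r * (r%:R / N%:R)
      <= C * (M%:R / N%:R * A + (AS K - AS M)) by rewrite ler_pM2l.
  have ASK : AS K <= A by exact: partial_sum_le_rho_c.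
  have : C * (AS K - AS M) <= C * (eta / (4 * (C + 1))).
    by rewrite ler_pM2l//; lra.
  rewrite mulrDr; lra.
have B2 : `|Rem| <= eta / 4.
  by rewrite ger0_norm /Rem; move: rem0 rem1 HK eC'; rewrite -/e; clear; lra.
have B3 : `|\sum_(K.+1 <= r < N.+1) a r * q r * (1 - e r)| <= eta / 4.
  have -> : eta / 4 = rho * (eta / (4 * rho)) by field; exact: lt0r_neq0.
  apply: (@le_trans _ _ (\sum_(K.+1 <= r < N.+1) a r * q r * (eta / (4 * rho)))).
    apply: (le_trans (ler_norm_sum _ _ _)).
    apply: ler_sum_nat => r /andP[Kr _]; have /andP[er0 er1] := e01 r.
    have aq0 : 0 <= a r * q r by rewrite mulr_ge0// ltW.
    rewrite normrM (ger0_norm aq0) ger0_norm ?subr_ge0//.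
    apply: ler_wpM2l => //.
    have rR : eps * N%:R <= r%:R.
      by apply: ltW; apply: (lt_le_trans Ku); rewrite ler_nat.
    have eN0 : 0 < eps * N%:R by rewrite mulr_gt0.
    have r0 : 0 < r%:R :> R by exact: lt_le_trans rR.
    apply: (@le_trans _ _ (s ^+ 2 / (2 * (r%:R * beta)))).
      have := expR_ge1Dx (- (s ^+ 2 / (2 * (r%:R * beta)))).
      rewrite -/(heat_factor beta s r) -/(e r); lra.
    rewrite ler_pdivrMr ?mulr_gt0//; apply: (le_trans s2).
    have L2 := HN2 N NN2.
    apply: (@le_trans _ _
      (d%:R * (eta * (2 * beta * eps) / (4 * rho * d%:R) * N%:R))).
      by rewrite ler_pM2l.
    have -> : d%:R * (eta * (2 * beta * eps) / (4 * rho * d%:R) * N%:R)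
      = eta / (4 * rho) * (2 * (eps * N%:R * beta)).
      by field; rewrite !lt0r_neq0.
    by rewrite ler_pM2l ?divr_gt0 ?mulr_gt0// ler_pM2l// ler_pM2r.
  rewrite -mulr_suml ler_pM2r ?divr_gt0 ?mulr_gt0//.
  rewrite -[leRHS]diagK lerDr; apply: sumr_ge0 => r _.
  by rewrite mulr_ge0// ltW.
apply: (le_lt_trans (ler_normB _ _)).
have := ler_normD (\sum_(1 <= r < K.+1) a r * (1 - q r) * (1 - e r)) Rem.
by lra.
Qed.

Theorem proposition1p5 (R : realType) (d : nat) (hd : (3 <= d)%N)
    (beta rho : R) (hbeta : 0 < beta) (hrho : 0 < rho)
    (dO : measure_display) (Omega : measurableType dO)
    (P : R -> probability Omega R) (X : nat -> {mfun Omega >-> nat})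
    (hP : forall L : R, 0 < L -> free_cycle_law d beta L (P L) X) :
  let box N : set 'rV[R]_d := centred_box (side d rho N) in
  let gamma N (x y : 'rV[R]_d) : R :=
    gamma_free (P (side d rho N)) X beta N x y in
  (rho_c d beta < rho ->
    exists psi : R -> R,
      [/\ forall r, 0 < r -> 0 < psi r,
          exists C : R, \forall r \near +oo, psi r <= C * r `^ (2 - d%:R) &
          forall eps : R, 0 < eps -> \forall N \near \oo,
            forall x y : 'rV[R]_d, box N x -> box N y ->
              `|gamma N x y
                - (rho - rho_c d beta + psi (euclidean_norm (x - y)))| < eps])
  /\
  (rho <= rho_c d beta ->
    exists c : R,
      [/\ 0 < c,
          forall x y : 'rV[R]_d, exists C : R, \forall N \near \oo,
            box N x -> box N y ->
              `|gamma N x y| <= C * expR (- (c * euclidean_norm (x - y))) &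
          rho < rho_c d beta -> exists C : R, \forall N \near \oo,
            forall x y : 'rV[R]_d, box N x -> box N y ->
              `|gamma N x y| <= C * expR (- (c * euclidean_norm (x - y)))]).
Proof.
move=> box gamma.
have d0 : (0 < d)%N by exact: leq_trans hd.
have gas N : (0 < N)%N ->
    (forall n, 0 < prob_total (P (side d rho N)) X n) /\
    cycle_recursion (N%:R / rho) (loop_weight d beta)
      (prob_total (P (side d rho N)) X).
  move=> N0; rewrite -(@side_exp _ d)//; have L0 := side_gt0 d hrho N0.
  exact: free_gas_recursion hd hbeta L0 (hP _ L0).
split=> [rhoc|rho_le].
  exists (loop_sum d beta); split.
  - by move=> r _; exact: loop_sum_gt0.
  - have [C HC] := loop_sum_decay hd hbeta; exists C.
    by near=> r; apply: HC; near: r; exact: nbhs_pinfty_ge.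
  - move=> eps eps0; have [N0 HN] := supercritical_kernel_limit hd hbeta rhoc eps0.
    exists (maxn N0 1) => // N /=; rewrite geq_max => /andP[N0N N1] x y bx bY.
    have [p0 rec] := gas N N1; rewrite /gamma gamma_freeE.
    by apply: HN => //; exact: box_dist_sqr_le.
(* For fixed points the constant may depend on the distance, and the bound by
   [rho] is enough for any rate [c]. *)
have pointwise c : forall x y : 'rV[R]_d, exists C : R, \forall N \near \oo,
    box N x -> box N y ->
    `|gamma N x y| <= C * expR (- (c * euclidean_norm (x - y))).
  move=> x y; exists (rho * expR (c * euclidean_norm (x - y))).
  exists 1%N => // N /= N1 _ _; have [p0 rec] := gas N N1.
  rewrite /gamma gamma_freeE ger0_norm ?kernel_ge0//.
  by rewrite -mulrA -expRD subrr expR0 mulr1; exact: kernel_le_density.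
have [rho_lt|rho_ge] := ltP rho (rho_c d beta); last by exists 1; split.
have rho_itv : 0 < rho < rho_c d beta by rewrite hrho.
have [c [N0 [c0 HN]]] := subcritical_kernel_decay hd hbeta rho_itv.
exists c; split => // _; exists (rho_c d beta).
exists (maxn N0 1) => // N /=; rewrite geq_max => /andP[N0N N1] x y bx bY.
have [p0 rec] := gas N N1.
by rewrite /gamma gamma_freeE ger0_norm ?kernel_ge0//; exact: HN.
Unshelve. all: by end_near. Qed.
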